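(* Let $H_{2n+1}$ be the Heisenberg Lie group of dimension $2n+1$. Any left invariant pseudo-Riemannian metric on $H_{2n+1}$ for which the center is non degenerate is naturally reductive. Moreover, writing the Lie algebra as an orthogonal direct sum $\mathfrak h_{2n+1}=\mathbb R z\oplus\mathfrak v$, where $\mathbb R z$ is the center and $\mathfrak v=(\mathbb R z)^\perp\cong\mathbb R^{2n}$, letting $B$ be the restriction of the metric to $\mathfrak v$ and $t\in\mathfrak{so}(\mathfrak v,B)$ the map defined by $B(tu,v)=\langle z,[u,v]\rangle$ for $u,v\in\mathfrak v$, the isotropy group (the group of isometries fixing the identity) has Lie algebra $$\mathfrak h=\mathcal Z_{\mathfrak{so}(\mathfrak v,B)}(t),$$ the centralizer of $t$ in $\mathfrak{so}(\mathfrak v,B)$.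
   Context: $H_{2n+1}$ is the simply connected Lie group with Lie algebra the Heisenberg Lie algebra $\mathfrak h_{2n+1}$ of dimension $2n+1$. The center is non degenerate if the metric restricted to the center of the Lie algebra is non degenerate. $\mathfrak{so}(\mathfrak v,B)$ is the Lie algebra of linear maps of $\mathfrak v$ that are skew-adjoint with respect to the non degenerate symmetric bilinear form $B$. An element $C$ of the centralizer acts on $\mathfrak h_{2n+1}$ by $0$ on $\mathbb R z$ and by $C$ on $\mathfrak v$. Naturally reductive: a homogeneous pseudo-Riemannian manifold $M$ is naturally reductive if there is a transitive Lie group $G$ of isometries, with Lie algebra $\mathfrak g$ and isotropy group $K$ (at a base point) with Lie algebra $\mathfrak k$, and a subspace $\mathfrak m\subseteq\mathfrak g$ complementary to $\mathfrak k$ such that $\mathrm{Ad}(K)\mathfrak m\subseteq\mathfrak m$ and $\langle[x,y]_{\mathfrak m},w\rangle+\langle y,[x,w]_{\mathfrak m}\rangle=0$ for all $x,y,w\in\mathfrak m$, where the subscript $\mathfrak m$ denotes projection along $\mathfrak k$ and the metric on $\mathfrak m$ comes from its identification with the tangent space at the base point. *)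

(* Defs.v *)
From HB Require Import structures.
From mathcomp Require Import all_boot all_order all_algebra.
From mathcomp Require Import all_classical all_reals all_analysis.
From mathcomp Require Import ring.

Set Implicit Arguments.
Unset Strict Implicit.
Unset Printing Implicit Defensive.

Import Order.TTheory GRing.Theory Num.Theory.
Import numFieldNormedType.Exports.

Local Open Scope classical_set_scope.
Local Open Scope ring_scope.

(* C^k on the open set O. On the finite-dimensional spaces used below,
   requiring x |-> 'd f x v to be C^k for every v is the usual C^k.+1. *)
Fixpoint Ck_on (R : realType) (V W : normedModType R) (O : set V) (k : nat)
    (f : V -> W) : Prop :=
  match k with
  | 0 => forall x, O x -> {for x, continuous f}
  | k'.+1 => (forall x, O x -> differentiable f x) /\
             (forall v, Ck_on O k' (fun x => 'd f x v))
  end.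

Definition smooth_on (R : realType) (V W : normedModType R) (O : set V)
    (f : V -> W) : Prop :=
  open O /\ forall k, Ck_on O k f.

Definition smooth (R : realType) (V W : normedModType R) (f : V -> W) : Prop :=
  smooth_on setT f.

(* cinv matters only on the image of cdom, cmap only on cdom. *)
Record chart (R : realType) (M : Type) (d : nat) := Chart {
  cdom : set M;
  cmap : M -> 'rV[R]_d;
  cinv : 'rV[R]_d -> M }.

Definition crange (R : realType) (M : Type) (d : nat) (c : chart R M d) :
  set 'rV[R]_d := cmap c @` cdom c.

(* The topology of a manifold is the one induced by its atlas. *)
Definition atlas_open (R : realType) (M : Type) (d : nat)
    (A : set (chart R M d)) (O : set M) : Prop :=
  forall c, A c -> open (cmap c @` (cdom c `&` O)).

(* The last two clauses say that the topology is second countable (countably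
   many charts cover M) and Hausdorff. *)
Definition smooth_atlas (R : realType) (M : Type) (d : nat)
    (A : set (chart R M d)) : Prop :=
  [/\ forall c x, A c -> cdom c x -> cinv c (cmap c x) = x,
      forall c c', A c -> A c' ->
        smooth_on (cmap c @` (cdom c `&` cdom c')) (cmap c' \o cinv c),
      exists C : nat -> chart R M d,
        (forall i, A (C i)) /\ (forall x, exists i, cdom (C i) x) &
      forall x y, x <> y -> exists O O' : set M,
        [/\ atlas_open A O, atlas_open A O', O x, O' y & O `&` O' = set0] ].

(* In the smoothness clauses, openness of the set of parameters whose image
   lies in the target chart expresses continuity. *)
Record lieGroup (R : realType) := LieGroup {
  lie_group :> groupType;
  lie_dim : nat;
  lie_atlas : set (chart R lie_group lie_dim);
  lie_atlasP : smooth_atlas lie_atlas;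
  lie_mulP : forall c1 c2 c3,
    lie_atlas c1 -> lie_atlas c2 -> lie_atlas c3 ->
    smooth_on
      [set p : 'rV[R]_lie_dim * 'rV[R]_lie_dim |
        [/\ crange c1 p.1, crange c2 p.2 &
            cdom c3 (cinv c1 p.1 * cinv c2 p.2)%g]]
      (fun p => cmap c3 (cinv c1 p.1 * cinv c2 p.2)%g);
  lie_invP : forall c1 c2, lie_atlas c1 -> lie_atlas c2 ->
    smooth_on [set p | crange c1 p /\ cdom c2 (cinv c1 p)^-1%g]
      (fun p => cmap c2 (cinv c1 p)^-1%g) }.

Section LieAlgebra.
Context (R : realType) (G : lieGroup R).

(* The Lie algebra of G is T_1 G, identified with 'rV[R]_(lie_dim G) through
   a chart c around 1. *)
Variable c : chart R G (lie_dim G).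

Definition Ad (a : G) (X : 'rV[R]_(lie_dim G)) : 'rV[R]_(lie_dim G) :=
  'd (fun p => cmap c (a * cinv c p * a^-1)%g) (cmap c 1%g) X.

(* [X, Y] = ad X Y, where ad is the differential of Ad at 1. *)
Definition lie_bracket (X Y : 'rV[R]_(lie_dim G)) : 'rV[R]_(lie_dim G) :=
  'd (fun p => Ad (cinv c p) Y) (cmap c 1%g) X.

Definition one_parameter_subgroup (gam : R -> G) : Prop :=
  (forall s s', gam (s + s') = (gam s * gam s')%g) /\
  (forall c', lie_atlas c' ->
     smooth_on [set s | cdom c' (gam s)] (fun s => cmap c' (gam s))).

Definition subgroup_lie_algebra (K : set G) : set 'rV[R]_(lie_dim G) :=
  [set X | exists gam : R -> G,
     [/\ one_parameter_subgroup gam, (forall s, K (gam s)) &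
         is_derive (0 : R) (1 : R) (fun s => cmap c (gam s)) X]].

End LieAlgebra.

Section PseudoRiemannian.
Context (R : realType) (V : normedModType R).
Implicit Types (g : V -> V -> V -> R) (f : V -> V).

(* Metrics on the manifold V: g p is the scalar product on T_p V = V. *)
Definition pseudo_riemannian_metric g : Prop :=
  [/\ forall p (a : R) u u' w, g p (a *: u + u') w = a * g p u w + g p u' w,
      forall p u w, g p u w = g p w u,
      forall p u, (forall w, g p u w = 0) -> u = 0 &
      forall u w, smooth (fun p => g p u w)].

Definition isometry g f : Prop :=
  [/\ smooth f,
      exists f' : V -> V, [/\ smooth f', cancel f f' & cancel f' f] &
      forall p u w, g (f p) ('d f p u) ('d f p w) = g p u w].

(* The Lie algebra of the group of isometries fixing p, as a set of
   endomorphisms of T_p V through the (faithful) isotropy representation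
   f |-> 'd f p: the velocities at 0 of its one-parameter subgroups. *)
Definition isotropy_lie_algebra g (p : V) : set {linear V -> V} :=
  [set A | exists phi : R -> V -> V,
     [/\ smooth (fun sx : R * V => phi sx.1 sx.2),
         forall s s' x, phi (s + s') x = phi s (phi s' x),
         forall s, isometry g (phi s) /\ phi s p = p &
         forall u, is_derive (0 : R) (1 : R)
                     (fun s => 'd (phi s) p u) (A u)]].

Definition smooth_action (G : lieGroup R) (act : G -> V -> V) : Prop :=
  [/\ forall x, act 1%g x = x,
      forall a b x, act (a * b)%g x = act a (act b x) &
      forall c, lie_atlas c ->
        smooth_on [set p : 'rV[R]_(lie_dim G) * V | crange c p.1]
          (fun p => act (cinv c p.1) p.2)].

(* Clauses 3 and 4 make G a transitive group of isometries (an element is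
   determined by the isometry it defines). The scalar product carried by m is
   that of T_o V, through the differential at 1 of the orbit map a |-> act a o,
   which is onto with kernel k because G is transitive. *)
Definition naturally_reductive g : Prop :=
  exists (G : lieGroup R) (act : G -> V -> V) (o : V)
         (c : chart R G (lie_dim G)) (k m : {vspace 'rV[R]_(lie_dim G)}),
    let K : set G := [set a | act a o = o] in
    let dorb : 'rV[R]_(lie_dim G) -> V :=
      fun X => 'd (fun p => act (cinv c p) o) (cmap c 1%g) X in
    let proj_m := daddv_pi m k in
    [/\ lie_atlas c /\ cdom c 1%g,
        smooth_action act,
        (forall a, isometry g (act a)) /\
          (forall a, act a = id -> a = 1%g),
        forall x y, exists a, act a x = y &
        [/\ forall X, X \in k <-> subgroup_lie_algebra c K X,
            (m :&: k = 0)%VS /\ (m + k = fullv)%VS,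
            forall a X, K a -> X \in m -> Ad c a X \in m &
            forall x y w, x \in m -> y \in m -> w \in m ->
              g o (dorb (proj_m (lie_bracket c x y))) (dorb w) +
              g o (dorb y) (dorb (proj_m (lie_bracket c x w))) = 0]].

End PseudoRiemannian.

Definition skew_adjoint (R : realType) (W : vectType R) (B : W -> W -> R) :
  set 'End(W) := [set C | forall u w, B (C u) w = - B u (C w)].

Definition centralizer (R : realType) (W : vectType R) (S : set 'End(W))
  (t : 'End(W)) : set 'End(W) := [set C | S C /\ (C \o t = t \o C)%VF].

(* The Heisenberg Lie algebra R^n x R^n x R, with
   [(x, y, z), (x', y', z')] = (0, 0, x . y' - y . x'). *)
Notation heis R n := ('rV[R]_n * 'rV[R]_n * R)%type.

Section Heisenberg.
Context (R : realType) (n : nat).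
Implicit Types (p q u w : heis R n).

Definition heis_bracket u w : heis R n :=
  (0, 0, (u.1.1 *m w.1.2^T) 0 0 - (u.1.2 *m w.1.1^T) 0 0).

Definition heis_center : set (heis R n) :=
  [set c | forall u, heis_bracket c u = 0].

(* The simply connected Lie group of this Lie algebra in exponential
   coordinates (Baker-Campbell-Hausdorff); the unit is 0 and the inverse of p
   is - p. *)
Definition heis_mul p q : heis R n := p + q + 2^-1 *: heis_bracket p q.

Let dotDl (x y w : 'rV[R]_n) :
  ((x + y) *m w^T) 0 0 = (x *m w^T) 0 0 + (y *m w^T) 0 0.
Proof. by rewrite mulmxDl mxE. Qed.

Let dotDr (x y w : 'rV[R]_n) :
  (x *m (y + w)^T) 0 0 = (x *m y^T) 0 0 + (x *m w^T) 0 0.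
Proof. by rewrite linearD mulmxDr mxE. Qed.

Let dotN (x y : 'rV[R]_n) :
  ((- x) *m y^T) 0 0 = - (x *m y^T) 0 0 /\ (x *m (- y)^T) 0 0 = - (x *m y^T) 0 0.
Proof. by rewrite linearN mulmxN mulNmx mxE. Qed.

Let dotC (x y : 'rV[R]_n) : (x *m y^T) 0 0 = (y *m x^T) 0 0.
Proof. by rewrite -{1}(trmxK x) -trmx_mul mxE. Qed.

Lemma heis_mulA : associative heis_mul.
Proof.
move=> [[x y] a] [[x' y'] a'] [[x'' y''] a'']; rewrite /heis_mul /heis_bracket /=.
congr (_, _, _); rewrite /= ?scaler0 ?addr0 ?addrA //.
by rewrite !dotDl !dotDr /GRing.scale /=; ring.
Qed.

Lemma heis_mul0 : left_id 0 heis_mul.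
Proof.
move=> [[x y] a]; rewrite /heis_mul /heis_bracket /= !mul0mx !mxE subrr.
by rewrite add0r scaler0 addr0.
Qed.

Lemma heis_mulN : left_inverse 0 (@GRing.opp _) heis_mul.
Proof.
move=> [[x y] a]; rewrite /heis_mul /heis_bracket /= !(dotN _ _).1 (dotC y).
by rewrite addNr add0r subrr scaler0.
Qed.

(* Ad p = id + ad p: heis_bracket is the Lie bracket of heis_mul. *)
Lemma heis_conj p q : heis_mul (heis_mul p q) (- p) = q + heis_bracket p q.
Proof.
case: p q => [[x y] a] [[x' y'] a']; rewrite /heis_mul /heis_bracket /=.
congr (_, _, _); rewrite /= ?scaler0 ?addr0; try by rewrite addrAC subrr add0r.
rewrite !dotDl !(dotN _ _).2 (dotC y' x) (dotC x' y) (dotC y x) /GRing.scale /=.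
by field.
Qed.

Definition left_invariant (g : heis R n -> heis R n -> heis R n -> R) : Prop :=
  forall a p u w,
    g (heis_mul a p) ('d (heis_mul a) p u) ('d (heis_mul a) p w) = g p u w.

End Heisenberg.

(* Main.v *)
(** Left invariance determines the metric by the scalar product [b = g 0].  Let
    [t] be the skew map with [b (t u) w = b z [u, w]].

    Naturally reductive: [t] is a skew derivation, so its flow acts by isometric
    automorphisms.  Let [G] be generated by this flow and the left translations,
    an effective quotient of [V >< R]; its isotropy group at [0] is the flow.
    For [m] take the graph of [u |-> (b z u / b z z) t].

    Isotropy algebra: the velocity of a one-parameter group of isometries fixing
    [0] is a Killing field.  Let [X] be its left trivialisation, [h w = b X w]
    and [E u] the derivative along the left-invariant field of [u].  For [u], [w]
    orthogonal to [z] the Killing equation reads [E z (h z) = 0],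
    [E u (h z) + E z (h u) = - h (t u)] and [E u (h w) + E w (h u) = 0].  Using
    [[E u, E w] = om u w E z], two further differentiations give
    [b (t w) (t w) E z (h (t w)) = 0]; as the non-null vectors are dense,
    [E z (h u) = 0].  Then [E u E w (h z) = - E u (h (t w))] is symmetric in [u]
    and [w], which at [0] says that the velocity commutes with [t].  Conversely
    a skew map commuting with [t] generates a flow of isometric automorphisms. *)
Require Import Defs.
From HB Require Import structures.
From mathcomp Require Import all_boot all_order all_algebra.
From mathcomp Require Import all_classical all_reals all_analysis.
From mathcomp Require Import ring lra.

Set Implicit Arguments.
Unset Strict Implicit.
Unset Printing Implicit Defensive.

Import Order.TTheory GRing.Theory Num.Theory.
Import numFieldNormedType.Exports.

Local Open Scope classical_set_scope.
Local Open Scope ring_scope.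

(** * Smooth maps *)

Section SmoothCalculus.
Context (R : realType).
Implicit Types U V W : normedModType R.

(** Two obstacles shape the group. It must act effectively, but the flow of [t] may be periodic, and
    it may also wind densely in a torus of linear maps; so the rotation factor is neither always a
    line nor always a closed subgroup. It is therefore stored as a set of maps [phi s] and charted
    by the angle [s], which is locally determined because [t] is not zero. The slope of the
    complement is forced. For the graph of [u |-> l (b z u / b z z) t] with a scalar [l], the terms
    with [t] acting on both arguments cancel by skewness, and the identity for x, y, w reduces to
    [(1 - l) (om x y * b z w + om x w * b z y) = 0], hence [l = 1]. For the isotropy algebra the
    obstacle is that [b] may be indefinite: the relation obtained from the Killing equation carries
    the factor [b (t w) (t w)], which may vanish although [t w] does not. *)

Lemma Ck_onS V W (O : set V) k (f : V -> W) : Ck_on O k.+1 f -> Ck_on O k f.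
Proof.
elim: k f => [|k IH] f /= [df H]; first by move=> x /df /differentiable_continuous.
by split=> // v; apply: IH.
Qed.

Lemma Ck_on_is_diff V W (O : set V) k (f : V -> W) (df : V -> V -> W) :
  (forall x, is_diff x f (df x)) -> (forall v, Ck_on O k (df ^~ v)) ->
  Ck_on O k.+1 f.
Proof.
move=> fP dfk; split=> [x _|v]; first exact: ex_diff.
by rewrite (_ : (fun _ => _) = df ^~ v)//; apply/funext => x; rewrite diff_val.
Qed.

Lemma diff_valE V W (f df : V -> W) x : is_diff x f df -> forall v, 'd f x v = df v.
Proof. by move=> [_ ->]. Qed.

Lemma smoothP V W (f : V -> W) : (forall k, Ck_on setT k f) -> smooth f.
Proof. by split=> //; exact: openT. Qed.

Lemma smoothCk V W (f : V -> W) k : smooth f -> Ck_on setT k f.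
Proof. by case. Qed.

Lemma smooth_is_diff V W (f : V -> W) (df : V -> V -> W) :
  (forall x, is_diff x f (df x)) -> (forall v, smooth (df ^~ v)) -> smooth f.
Proof.
move=> fP dfs; apply: smoothP => k; apply: Ck_onS.
by apply: (Ck_on_is_diff fP) => v; exact: smoothCk.
Qed.

Lemma smooth_differentiable V W (f : V -> W) x : smooth f -> differentiable f x.
Proof. by move=> [_ /(_ 1%N)[+ _]]; apply. Qed.

Lemma smooth_diff V W (f : V -> W) v : smooth f -> smooth (fun x => 'd f x v).
Proof. by move=> [_ fs]; apply: smoothP => k; have [_ ] := fs k.+1; exact. Qed.

Lemma smooth_continuous V W (f : V -> W) : smooth f -> continuous f.
Proof. by move=> fs x; exact/differentiable_continuous/smooth_differentiable. Qed.

Lemma near_eq_is_diff V W (f g df : V -> W) x :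
  (\near x, f x = g x) -> is_diff x f df -> is_diff x g df.
Proof.
move=> fg [fd <-].
have H : continuous ('d f x) /\ g \o shift x = cst (g x) + 'd f x +o_ 0 id.
  split; first exact: diff_continuous.
  apply/eqaddoP => e e0.
  have /diff_locally/eqaddoP/(_ e e0) := fd.
  have fg0 : \forall h \near 0, f (h + x) = g (h + x).
    by move/nbhs0P : fg; apply: filterS => h; rewrite addrC.
  apply: filterS2 fg0 => h fgh.
  by rewrite -(nbhs_singleton fg) !fctE /= fgh.
have gd : 'd g x = 'd f x :> (V -> W) by apply: diff_unique; case: H.
by apply: DiffDef; rewrite // -?gd//; apply/diff_locallyP; rewrite gd.
Qed.

(** Maps read in the charts below agree near each point with a globally smooth map. The calculus is
    therefore developed for total functions, and this lemma brings it back to open sets. *)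
Lemma smooth_on_near V W (O : set V) (f : V -> W) : open O ->
  (forall x, O x -> exists2 F, smooth F & \near x, f x = F x) -> smooth_on O f.
Proof.
move=> oO fF; split=> // k; elim: k f fF => [|k IH] f fF.
  move=> x /fF[F Fs fFx].
  have /(_ x) := smooth_continuous Fs; rewrite /prop_for /continuous_at.
  rewrite -(nbhs_singleton fFx); apply: cvg_trans.
  by apply: near_eq_cvg; apply: filterS fFx.
have dfF x F : smooth F -> (\near x, f x = F x) -> is_diff x f ('d F x).
  move=> Fs fFx; apply: (@near_eq_is_diff _ _ F); first by apply: filterS fFx.
  by apply: differentiableP; exact: smooth_differentiable.
split=> [x /fF[F Fs] /(dfF _ _ Fs)//|v]; apply: IH => x /fF[F Fs fFx].
exists (fun y => 'd F y v); first exact: smooth_diff.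
(* The equality holds on a neighbourhood of every point close to [x], so the differentials agree
   near [x] as well. *)
move: (fFx) => /nbhs_interior; apply: filterS => y fFy.
by have dy := dfF y F Fs fFy; rewrite diff_val.
Qed.

Lemma smooth_cst V W (w : W) : smooth (fun _ : V => w).
Proof.
apply: smoothP => k; elim: k w => [|k IH] w; first by move=> x _; exact: cst_continuous.
by apply: (@Ck_on_is_diff _ _ _ _ (cst w) (fun _ => 0)) => v; exact: IH.
Qed.

Lemma is_diff_linear V W (f : V -> W) x : linear f -> continuous f -> is_diff x f f.
Proof.
move=> fl fc; pose F : {linear V -> W} := HB.pack f (GRing.isLinear.Build _ _ _ _ f fl).
by apply: DiffDef; [exact: (@linear_differentiable _ _ _ F)|exact: (@diff_lin _ _ _ F)].
Qed.

Lemma smooth_linear V W (f : V -> W) : linear f -> continuous f -> smooth f.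
Proof.
move=> fl fc; apply: (@smooth_is_diff _ _ _ (fun=> f)) => [x|v].
  exact: is_diff_linear.
exact: smooth_cst.
Qed.

Lemma smooth_id V : smooth (@id V).
Proof. by apply: smooth_linear => // x; exact: cvg_id. Qed.

Lemma Ck_onD V W (f g : V -> W) k : Ck_on setT k f -> Ck_on setT k g ->
  Ck_on setT k (fun x => f x + g x).
Proof.
elim: k f g => [|k IH] f g.
  by move=> fc gc x _; apply: (@continuousD _ _ _ f g); [exact: fc|exact: gc].
move=> [fd dfk] [gd dgk].
apply: (@Ck_on_is_diff _ _ _ _ _ (fun x v => 'd f x v + 'd g x v)) => [x|v].
  by apply: is_diffD; apply: differentiableP; [exact: fd|exact: gd].
by apply: IH; [exact: dfk|exact: dgk].
Qed.

Lemma smoothD V W (f g : V -> W) : smooth f -> smooth g ->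
  smooth (fun x => f x + g x).
Proof. by move=> fs gs; apply: smoothP => k; apply: Ck_onD; exact: smoothCk. Qed.

Lemma Ck_onM V (f g : V -> R) k : Ck_on setT k f -> Ck_on setT k g ->
  Ck_on setT k (fun x => f x * g x).
Proof.
elim: k f g => [|k IH] f g.
  by move=> fc gc x _; apply: (@continuousM _ _ f g); [exact: fc|exact: gc].
move=> /[dup] /Ck_onS fk [fd dfk] /[dup] /Ck_onS gk [gd dgk].
apply: (@Ck_on_is_diff _ _ _ _ _ (fun x v => f x * 'd g x v + g x * 'd f x v)) => [x|v].
  by apply: is_diffM; apply: differentiableP; [exact: fd|exact: gd].
by apply: Ck_onD; apply: IH => //; [exact: dgk|exact: dfk].
Qed.

Lemma smoothM V (f g : V -> R) : smooth f -> smooth g ->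
  smooth (fun x => f x * g x).
Proof. by move=> fs gs; apply: smoothP => k; apply: Ck_onM; exact: smoothCk. Qed.

Lemma is_diff_Zl V W (f : V -> R) (df : V -> R) (w : W) x :
  is_diff x f df -> is_diff x (fun y => f y *: w) (fun v => df v *: w).
Proof.
move=> [fd <-]; apply: DiffDef; first exact: differentiableZl.
by rewrite diffZl.
Qed.

Lemma smoothZl V W (f : V -> R) (w : W) : smooth f -> smooth (fun x => f x *: w).
Proof.
move=> [_ fs]; apply: smoothP => k; elim: k f {fs}(fs k) => [|k IH] f.
  by move=> fc x _; apply: continuousZr_tmp; exact: fc.
move=> [fd dfk].
apply: (@Ck_on_is_diff _ _ _ _ _ (fun x v => 'd f x v *: w)) => [x|v].
  by apply: is_diff_Zl; apply: differentiableP; exact: fd.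
by apply: IH; exact: dfk.
Qed.

Lemma smooth_sum V W d (f : 'I_d -> V -> W) : (forall i, smooth (f i)) ->
  smooth (fun x => \sum_i f i x).
Proof.
elim: d f => [|d IH] f fs.
  by under eq_fun do rewrite big_ord0; exact: smooth_cst.
under eq_fun do rewrite big_ord_recl.
by apply: smoothD => //; apply: IH.
Qed.

Lemma smoothN V W (f : V -> W) : smooth f -> smooth (fun x => - f x).
Proof.
move=> [_ fs]; apply: smoothP => k; elim: k f {fs}(fs k) => [|k IH] f.
  by move=> fc x _; apply: continuousN; exact: fc.
move=> [fd dfk].
apply: (@Ck_on_is_diff _ _ _ _ _ (fun x v => - 'd f x v)) => [x|v].
  by apply: is_diffN; apply: differentiableP; exact: fd.
by apply: IH; exact: dfk.
Qed.

Lemma smoothB V W (f g : V -> W) : smooth f -> smooth g ->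
  smooth (fun x => f x - g x).
Proof. by move=> fs gs; apply: smoothD => //; exact: smoothN. Qed.

(* Composition on the right is only needed with affine maps, for which it is
   enough to differentiate in fixed directions. *)
Lemma is_diff_comp_affine U V W (f df : V -> W) (l : U -> V) b x :
  linear l -> continuous l -> is_diff (l x + b) f df ->
  is_diff x (fun y => f (l y + b)) (fun v => df (l v)).
Proof.
move=> ll lc fd.
have ld : is_diff x (fun y => l y + b) l.
  have H := @is_diffD _ _ _ l (cst b) l 0 x (is_diff_linear x ll lc) (is_diff_cst b x).
  by apply: is_diff_eq H _; apply/funext => v; exact: addr0.
exact: is_diff_comp.
Qed.

Lemma is_diff_comp_linear U V W (f df : V -> W) (l : U -> V) x :
  linear l -> continuous l -> is_diff (l x) f df ->
  is_diff x (fun y => f (l y)) (fun v => df (l v)).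
Proof. by move=> ll lc fd; have ld := is_diff_linear x ll lc; exact: is_diff_comp. Qed.

Lemma smooth_comp_affine U V W (f : V -> W) (l : U -> V) b :
  linear l -> continuous l -> smooth f -> smooth (fun x => f (l x + b)).
Proof.
move=> ll lc [_ fs]; apply: smoothP => k; elim: k f {fs}(fs k) => [|k IH] f.
  move=> fc x _; apply: (@continuous_comp _ _ _ (fun x => l x + b) f); last exact: fc.
  by apply: continuousD; [exact: lc|exact: cst_continuous].
move=> [fd dfk].
apply: (@Ck_on_is_diff _ _ _ _ _ (fun x v => 'd f (l x + b) (l v))) => [x|v].
  by apply: is_diff_comp_affine => //; apply: differentiableP; exact: fd.
by apply: (IH (fun y => 'd f y (l v))); exact: dfk.
Qed.

Lemma smooth_comp_linear U V W (f : V -> W) (l : U -> V) :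
  linear l -> continuous l -> smooth f -> smooth (fun x => f (l x)).
Proof.
move=> ll lc fs; have := smooth_comp_affine 0 ll lc fs.
by under eq_fun do rewrite addr0.
Qed.

Lemma is_diff_linear_comp U V W (f df : U -> V) (l : V -> W) x :
  linear l -> continuous l -> is_diff x f df ->
  is_diff x (fun y => l (f y)) (fun v => l (df v)).
Proof.
move=> ll lc fd.
by apply: (@is_diff_comp _ _ _ _ f df l l); exact: is_diff_linear.
Qed.

Lemma smooth_linear_comp U V W (f : U -> V) (l : V -> W) :
  linear l -> continuous l -> smooth f -> smooth (fun x => l (f x)).
Proof.
move=> ll lc [_ fs]; apply: smoothP => k; elim: k f {fs}(fs k) => [|k IH] f.
  move=> fc x _; apply: (@continuous_comp _ _ _ f l); [exact: fc|exact: lc].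
move=> [fd dfk].
apply: (@Ck_on_is_diff _ _ _ _ _ (fun x v => l ('d f x v))) => [x|v].
  by apply: is_diff_linear_comp => //; apply: differentiableP; exact: fd.
by apply: (IH (fun y => 'd f y v)); exact: dfk.
Qed.

Lemma is_diff_sum V W d (f df : 'I_d -> V -> W) x :
  (forall i, is_diff x (f i) (df i)) ->
  is_diff x (fun y => \sum_i f i y) (fun v => \sum_i df i v).
Proof.
elim: d f df => [|d IH] f df fd.
  under eq_fun do rewrite big_ord0; under [X in is_diff _ _ X]eq_fun do rewrite big_ord0.
  exact: is_diff_cst.
under eq_fun do rewrite big_ord_recl; under [X in is_diff _ _ X]eq_fun do rewrite big_ord_recl.
by apply: is_diffD => //; apply: IH.
Qed.

Lemma is_diff_is_derive V W (f df : V -> W) x v :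
  is_diff x f df -> is_derive x v f (df v).
Proof.
by move=> [fd <-]; apply: DeriveDef; [exact: diff_derivable|exact: deriveE].
Qed.

Lemma is_derive_is_diff W (f : R -> W) s w :
  is_derive s (1 : R) f w -> is_diff s f (fun v => v *: w).
Proof.
move=> [fd <-]; apply: DiffDef; first exact/derivable1_diffP.
by rewrite deriv1E// derive1E.
Qed.

(** Finite dimension in the form that the calculus consumes: with continuous linear coefficients,
    linear and bilinear maps become finite sums of scalar functions times fixed vectors. *)
Definition frame V d (e : 'I_d -> V) (c : 'I_d -> V -> R) :=
  [/\ forall i, linear (c i), forall i, continuous (c i) &
      forall x, x = \sum_i c i x *: e i].

Definition fin_dim V := exists d (e : 'I_d -> V) c, frame e c.

Lemma linear_sumZ V W (f : V -> W) d (k : 'I_d -> R) (e : 'I_d -> V) : linear f ->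
  f (\sum_i k i *: e i) = \sum_i k i *: f (e i).
Proof.
move=> fl; pose F : {linear V -> W} := HB.pack f (GRing.isLinear.Build _ _ _ _ f fl).
rewrite -[f]/(F : V -> W) linear_sum; apply: eq_bigr => i _.
by rewrite linearZ.
Qed.

Lemma fin_dim_linear_continuous V W (f : V -> W) :
  fin_dim V -> linear f -> continuous f.
Proof.
move=> [d [e [c [cl cc ce]]]] fl.
have -> : f = fun x => \sum_i c i x *: f (e i).
  by apply/funext => x; rewrite {1}(ce x) linear_sumZ.
apply: smooth_continuous; apply: smooth_sum => i; apply: smoothZl.
exact: smooth_linear.
Qed.

Lemma fin_dim_R : fin_dim R.
Proof.
exists 1%N, (fun=> 1), (fun=> id); split=> // [_ x|x]; first exact: cvg_id.
by rewrite big_ord1 [_ *: _]mulr1.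
Qed.

Lemma fin_dim_rV n : fin_dim 'rV[R]_n.
Proof.
exists n, (delta_mx 0), (fun j (x : 'rV[R]_n) => x 0 j); split=> [i a u v|i|x].
- by rewrite !mxE.
- exact: coord_continuous.
- exact: row_sum_delta.
Qed.

Lemma fst_linear V W : linear (@fst V W).
Proof. by move=> a [u u'] [v v']. Qed.

Lemma snd_linear V W : linear (@snd V W).
Proof. by move=> a [u u'] [v v']. Qed.

Lemma fst_continuous V W : continuous (@fst V W).
Proof. by move=> x; exact: cvg_fst. Qed.

Lemma snd_continuous V W : continuous (@snd V W).
Proof. by move=> x; exact: cvg_snd. Qed.

Lemma fin_dim_prod V W : fin_dim V -> fin_dim W -> fin_dim (V * W)%type.
Proof.
move=> [d [e [c [cl cc ce]]]] [d' [e' [c' [cl' cc' ce']]]].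
exists (d + d')%N, (fun i => match fintype.split i with inl j => (e j, 0) | inr j => (0, e' j) end),
  (fun i x => match fintype.split i with inl j => c j x.1 | inr j => c' j x.2 end).
split=> [i|i|[x y]].
- by case: (fintype.split i) => j a u v; [exact: cl|exact: cl'].
- case: (fintype.split i) => j x.
    exact: (@continuous_comp _ _ _ fst (c j)) (@fst_continuous _ _ _) (cc j _).
  exact: (@continuous_comp _ _ _ snd (c' j)) (@snd_continuous _ _ _) (cc' j _).
rewrite big_split_ord /=.
under eq_bigr => i _ do rewrite (unsplitK (inl i)).
under [X in _ + X]eq_bigr => i _ do rewrite (unsplitK (inr i)).
have E1 : \sum_i c i x *: (e i, 0) = (x, 0) :> V * W.
  rewrite [in RHS](ce x); elim/big_ind2 : _ => // [u u' v v' -> ->|i _].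
    by congr pair; rewrite /= ?addr0.
  by congr pair; rewrite /= scaler0.
have E2 : \sum_i c' i y *: (0, e' i) = (0, y) :> V * W.
  rewrite [in RHS](ce' y); elim/big_ind2 : _ => // [u u' v v' -> ->|i _].
    by congr pair; rewrite /= ?addr0.
  by congr pair; rewrite /= scaler0.
by rewrite E1 E2; congr pair; rewrite /= ?addr0 ?add0r.
Qed.

Section Bilinear.
Variables (U V W X : normedModType R) (b : V -> W -> X).
Hypotheses (V_fin : fin_dim V) (W_fin : fin_dim W).
Hypotheses (bl : forall y, linear (b ^~ y)) (br : forall x, linear (b x)).

Let b_sum d (k : 'I_d -> R) (e : 'I_d -> V) d' (k' : 'I_d' -> R) (e' : 'I_d' -> W) :
  b (\sum_i k i *: e i) (\sum_i k' i *: e' i) =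
  \sum_i \sum_j (k i * k' j) *: b (e i) (e' j).
Proof.
rewrite (linear_sumZ _ _ (bl _)); apply: eq_bigr => i _.
by rewrite (linear_sumZ _ _ (br _)) scaler_sumr; apply: eq_bigr => j _; rewrite scalerA.
Qed.

Lemma smooth_bilin (f : U -> V) (g : U -> W) : smooth f -> smooth g ->
  smooth (fun x => b (f x) (g x)).
Proof.
move: V_fin W_fin => [d [e [c [cl cc ce]]]] [d' [e' [c' [cl' cc' ce']]]] fs gs.
under eq_fun => x do rewrite (ce (f x)) (ce' (g x)) b_sum.
apply: smooth_sum => i; apply: smooth_sum => j; apply: smoothZl; apply: smoothM.
  exact: smooth_linear_comp.
exact: smooth_linear_comp.
Qed.

(** Leibniz rule, reduced by expansion in frames to the product rule for scalar coordinates. *)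
Lemma is_diff_bilin (f df : U -> V) (g dg : U -> W) x :
  is_diff x f df -> is_diff x g dg ->
  is_diff x (fun y => b (f y) (g y)) (fun v => b (f x) (dg v) + b (df v) (g x)).
Proof.
move: V_fin W_fin => [d [e [c [cl cc ce]]]] [d' [e' [c' [cl' cc' ce']]]] fd gd.
under eq_fun => y do rewrite (ce (f y)) (ce' (g y)) b_sum.
have H i j : is_diff x (fun y => (c i (f y) * c' j (g y)) *: b (e i) (e' j))
    (fun v => (c i (f x) * c' j (dg v) + c' j (g x) * c i (df v)) *: b (e i) (e' j)).
  apply: is_diff_Zl.
  by apply: is_diffM; exact: is_diff_linear_comp.
have := is_diff_sum (fun i => is_diff_sum (H i)).
move=> /is_diff_eq; apply; apply/funext => v.
rewrite {2}(ce (f x)) {2}(ce' (dg v)) {2}(ce (df v)) {2}(ce' (g x)) !b_sum -big_split.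
apply: eq_bigr => i _; rewrite -big_split; apply: eq_bigr => j _.
by rewrite /= -scalerDl [c' j _ * _]mulrC.
Qed.

End Bilinear.

Lemma smooth_pair U V W (f : U -> V) (g : U -> W) : smooth f -> smooth g ->
  smooth (fun x => (f x, g x)).
Proof.
move=> [_ fs] [_ gs]; apply: smoothP => k.
elim: k f g {fs gs}(fs k) (gs k) => [|k IH] f g.
  by move=> fc gc x _; apply: cvg_pair; [exact: fc|exact: gc].
move=> [fd dfk] [gd dgk].
apply: (@Ck_on_is_diff _ _ _ _ _ (fun x v => ('d f x v, 'd g x v))) => [x|v].
  by apply: is_diff_pair; apply: differentiableP; [exact: fd|exact: gd].
by apply: IH; [exact: dfk|exact: dgk].
Qed.

End SmoothCalculus.

(** * Symmetry of second derivatives *)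

Section Schwarz.
Context (R : realType) (V : normedModType R).
Implicit Types (F : V -> R) (p u w : V).

Lemma is_derive_line (W : normedModType R) (F : V -> W) p u (s : R) : smooth F ->
  is_derive s (1 : R) (fun s => F (s *: u + p)) ('d F (s *: u + p) u).
Proof.
move=> Fs; have lin : linear (fun s : R => s *: u) by move=> a x y; rewrite scalerDl scalerA.
have := is_diff_comp_affine (x := s) (b := p) lin _
  (differentiableP (smooth_differentiable _ Fs)).
move=> /(_ (fin_dim_linear_continuous (fin_dim_R R) lin))/(is_diff_is_derive (1 : R)).
by rewrite scale1r.
Qed.

(** The mean value theorem twice: in direction [u] for the increment along [w], then in direction
    [w] for the derivative along [u]. The left-hand side is symmetric in [u] and [w], which is what
    Schwarz's theorem needs. *)
Lemma second_difference F p u w (h : R) : smooth F -> 0 < h ->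
  exists a b : R, [/\ 0 < a < h, 0 < b < h &
    F (h *: u + (h *: w + p)) - F (h *: u + p) - (F (h *: w + p) - F p) =
    h * h * 'd (fun x => 'd F x u) (b *: w + (a *: u + p)) w].
Proof.
move=> Fs h0.
have cont (f df : R -> R) : (forall x, is_derive x (1 : R) f (df x)) ->
    {within `[0, h], continuous f}.
  move=> fd; apply: continuous_subspaceT => x.
  by apply/differentiable_continuous/derivable1_diffP; case: (fd x).
pose f (s : R) := F (s *: u + (h *: w + p)) - F (s *: u + p).
have fd s : is_derive s (1 : R) f
    ('d F (s *: u + (h *: w + p)) u - 'd F (s *: u + p) u).
  by apply: is_deriveB; exact: is_derive_line.
have [a ah fa] := MVT h0 (fun x _ => fd x) (cont _ _ fd).
pose g (t : R) := 'd F (t *: w + (a *: u + p)) u.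
have gd t : is_derive t (1 : R) g ('d (fun x => 'd F x u) (t *: w + (a *: u + p)) w).
  by apply: (is_derive_line (F := fun x => 'd F x u)); exact: smooth_diff.
have [b bh gb] := MVT h0 (fun x _ => gd x) (cont _ _ gd).
exists a, b; split; [by move: ah; rewrite in_itv|by move: bh; rewrite in_itv|].
move: fa gb; rewrite /f /g !scale0r !add0r !subr0 [h *: w + (_ + _)]addrCA => -> ->.
by rewrite -mulrA mulrC.
Qed.

Lemma schwarz F p u w : smooth F ->
  'd (fun x => 'd F x u) p w = 'd (fun x => 'd F x w) p u.
Proof.
move=> Fs; pose G := fun x => 'd (fun x => 'd F x u) x w.
pose H := fun x => 'd (fun x => 'd F x w) x u.
have Gc : continuous G by apply/smooth_continuous/smooth_diff/smooth_diff.
have Hc : continuous H by apply/smooth_continuous/smooth_diff/smooth_diff.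
suff : `|G p - H p| <= 0 by rewrite normr_le0 subr_eq0 => /eqP.
apply/ler_addgt0Pl => e e0; rewrite addr0.
have e20 : 0 < e / 2 by rewrite divr_gt0.
have : \forall x \near p, `|G p - G x| < e / 2 /\ `|H p - H x| < e / 2.
  by apply: filterI; [move/cvgrPdist_lt : (Gc p)|move/cvgrPdist_lt : (Hc p)]; exact.
move=> /nbhs_normP[d /= d0 dP].
(* Both intermediate points then lie within [h * (|u| + |w|) < d] of [p]; the summand 1 keeps the
   divisor positive and the inequality strict. *)
pose h := d / (`|u| + `|w| + 1).
have N0 : 0 < `|u| + `|w| + 1 by rewrite ltr_wpDl// addr_ge0.
have h0 : 0 < h by rewrite divr_gt0.
have near_p (a b : R) x y : 0 < a < h -> 0 < b < h -> `|x| + `|y| = `|u| + `|w| ->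
    `|p - (b *: y + (a *: x + p))| < d.
  move=> /andP[a0 ah] /andP[b0 bh] xy.
  rewrite addrA opprD addrCA subrr addr0 normrN (le_lt_trans (ler_normD _ _))//.
  rewrite !normrZ !gtr0_norm//.
  have : h * (`|u| + `|w| + 1) = d by rewrite divfK ?gt_eqF.
  rewrite -xy mulrDr mulr1 mulrDr => <-.
  have : b * `|y| <= h * `|y| by rewrite ler_wpM2r// ltW.
  have : a * `|x| <= h * `|x| by rewrite ler_wpM2r// ltW.
  lra.
have [a [b [ah bh E]]] := second_difference p u w Fs h0.
have [a' [b' [ah' bh' E']]] := second_difference p w u Fs h0.
have GH : G (b *: w + (a *: u + p)) = H (b' *: u + (a' *: w + p)).
  apply: (mulfI (x := h * h)); first by rewrite mulf_neq0 ?gt_eqF.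
  rewrite /G /H -E -E' [h *: w + (_ + _)]addrCA; ring.
have [G1 _] := dP _ (near_p _ _ _ _ ah bh erefl).
have [_ H1] := dP _ (near_p _ _ _ _ ah' bh' (addrC _ _)).
rewrite -(subrKA (G (b *: w + (a *: u + p)))) (le_trans (ler_normD _ _))//.
by rewrite [leRHS]splitr ltW// ltrD// GH distrC.
Qed.

End Schwarz.

(** * The flow of a linear vector field *)

Section ExponentialSeries.
Context (R : realType).
Implicit Types u v : nat -> R.

Definition exp_bounded u :=
  exists C K : R, [/\ 0 <= C, 0 <= K & forall k, `|u k| <= C * K ^+ k].

(** Exponential generating function of [u]. For a functional [l] and [u k = l (A^k x)] it is
    [l (exp (s A) x)], so operator exponentials reduce to scalar power series. *)
Definition eseries u (s : R) := limn (pseries (fun k => u k / k`!%:R) s).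

Lemma exp_bounded_shift u : exp_bounded u -> exp_bounded (fun k => u k.+1).
Proof.
move=> [C [K [C0 K0 uP]]]; exists (C * K), K; split=> // [|k]; first exact: mulr_ge0.
by rewrite -mulrA -exprS.
Qed.

Lemma cvg_eseries u s : exp_bounded u -> cvgn (pseries (fun k => u k / k`!%:R) s).
Proof.
move=> [C [K [C0 K0 uP]]]; apply: normed_cvg.
apply: (@series_le_cvg _ _ (C *: exp_coeff (K * `|s|))) => [k|k|k|].
- exact: normr_ge0.
- by apply: mulr_ge0 => //; apply: exp_coeff_ge0; exact: mulr_ge0.
- rewrite /= normrM normrM normrX [`|_^-1|]ger0_norm//.
  rewrite [leRHS](_ : _ = C * K ^+ k / k`!%:R * `|s| ^+ k); last first.
    by rewrite fctE /exp_coeff /GRing.scale /= exprMn; ring.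
  by rewrite !ler_wpM2r// exprn_ge0.
- by apply: is_cvg_seriesZ; exact: is_cvg_series_exp_coeff.
Qed.

Lemma eseries_linear a u v s : exp_bounded u -> exp_bounded v ->
  eseries (fun k => a * u k + v k) s = a * eseries u s + eseries v s.
Proof.
move=> ub vb; rewrite /eseries /pseries.
rewrite (_ : series (fun i => (a * u i + v i) / i`!%:R * s ^+ i) =
  series (a *: (fun i => u i / i`!%:R * s ^+ i) + (fun i => v i / i`!%:R * s ^+ i))).
  have [uc vc] := (@cvg_eseries u s ub, @cvg_eseries v s vb).
  by rewrite (lim_seriesD (is_cvg_seriesZ (k := a) uc) vc) (lim_seriesZ a uc).
by congr series; apply/funext => i; rewrite !fctE /GRing.scale /=; ring.
Qed.

Lemma exp_bounded0 : exp_bounded (fun=> 0).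
Proof. by exists 0, 0; split=> // k; rewrite normr0 mul0r. Qed.

Lemma exp_bounded_linear a u v : exp_bounded u -> exp_bounded v ->
  exp_bounded (fun k => a * u k + v k).
Proof.
move=> [C [K [C0 K0 uP]]] [D [L [D0 L0 vP]]].
exists (`|a| * C + D), (K + L); split=> [||k]; try exact: addr_ge0.
  by rewrite addr_ge0// mulr_ge0.
rewrite (le_trans (ler_normD _ _))// normrM mulrDl lerD//.
  rewrite -mulrA ler_wpM2l// (le_trans (uP k))// ler_wpM2l//.
  by rewrite lerXn2r ?nnegrE ?addr_ge0// lerDl.
by rewrite (le_trans (vP k))// ler_wpM2l// lerXn2r ?nnegrE ?addr_ge0// lerDr.
Qed.

Lemma eseries_cst0 s : eseries (fun=> 0) s = 0.
Proof.
have := eseries_linear 1 s exp_bounded0 exp_bounded0.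
under [X in eseries X]eq_fun do rewrite mulr0 addr0.
by rewrite mul1r; lra.
Qed.

Lemma exp_bounded_sum d (a : 'I_d -> R) (u : 'I_d -> nat -> R) :
  (forall i, exp_bounded (u i)) -> exp_bounded (fun k => \sum_i a i * u i k).
Proof.
elim: d a u => [|d IH] a u ub.
  by under eq_fun do rewrite big_ord0; exact: exp_bounded0.
under eq_fun do rewrite big_ord_recl.
by apply: exp_bounded_linear => //; exact: IH.
Qed.

Lemma eseries_sum d (a : 'I_d -> R) (u : 'I_d -> nat -> R) s :
  (forall i, exp_bounded (u i)) ->
  eseries (fun k => \sum_i a i * u i k) s = \sum_i a i * eseries (u i) s.
Proof.
elim: d a u => [|d IH] a u ub.
  by under [X in eseries X]eq_fun do rewrite big_ord0; rewrite big_ord0 eseries_cst0.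
under [X in eseries X]eq_fun do rewrite big_ord_recl.
by rewrite eseries_linear// ?IH ?big_ord_recl//; exact: exp_bounded_sum.
Qed.

Lemma eseries0 u : eseries u 0 = u 0%N.
Proof.
apply/cvg_lim => //; apply: cvg_near_cst.
near=> n; have n0 : (0 < n)%N by near: n; exists 1%N.
rewrite -(prednK n0) /pseries /series /= big_nat_recl//= expr0 fact0 divr1 mulr1.
by rewrite big1 ?addr0// => i _; rewrite expr0n mulr0.
Unshelve. all: by end_near. Qed.

(** The factor k + 1 produced by differentiation cancels against the factorial, which leaves the
    shifted sequence. *)
Lemma is_derive_eseries u s : exp_bounded u ->
  is_derive s (1 : R) (eseries u) (eseries (fun k => u k.+1) s).
Proof.
have diffs w : pseries_diffs (fun k => w k / k`!%:R) = (fun k => w k.+1 / k`!%:R).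
  apply/funext => k; rewrite /pseries_diffs factS natrM.
  by rewrite mulrCA invfM mulVKf ?pnatr_eq0.
move=> ub; have u1b := exp_bounded_shift ub; have u2b := exp_bounded_shift u1b.
rewrite /eseries -diffs; apply: (@pseries_snd_diffs _ _ (`|s| + 1)).
- exact: cvg_eseries.
- by rewrite diffs; exact: cvg_eseries.
- by rewrite !diffs; exact: cvg_eseries.
- by rewrite [ltRHS]ger0_norm ?addr_ge0// ltrDl.
Qed.

End ExponentialSeries.

Section LinearFlow.
Context (R : realType) (V : normedModType R).
Hypothesis V_fin : fin_dim V.
Variable A : V -> V.
Hypothesis A_linear : linear A.

Let AC : continuous A. Proof. exact: fin_dim_linear_continuous. Qed.

Lemma exp_bounded_iter (l : V -> R) x : linear l -> exp_bounded (fun k => l (iter k A x)).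
Proof.
move=> ll; have lc := fin_dim_linear_continuous V_fin ll.
pose F : {linear V -> V} := HB.pack A (GRing.isLinear.Build _ _ _ _ A A_linear).
pose L : {linear V -> R} := HB.pack l (GRing.isLinear.Build _ _ _ _ l ll).
have [K K0 AP] := @linear_lipschitz _ _ _ F AC.
have [C C0 lP] := @linear_lipschitz _ _ _ L lc.
exists (C * `|x|), K; split; [by rewrite mulr_ge0// ltW|exact: ltW|move=> k].
rewrite (le_trans (lP _))// -mulrA ler_wpM2l ?(ltW C0)//.
elim: k => [|k IH]; first by rewrite expr0 mulr1.
by rewrite iterS (le_trans (AP _))// exprS mulrCA ler_wpM2l// ltW.
Qed.

(* [phi s = exp (s A)] *)
Definition is_flow (phi : R -> V -> V) :=
  forall l : V -> R, linear l ->
    forall s x, l (phi s x) = eseries (fun k => l (iter k A x)) s.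

(** It is enough to prescribe the coordinates of [phi s x]: any other functional is a combination of
    them, and the series is linear in its coefficients. *)
Lemma flow_exists : exists phi, is_flow phi.
Proof.
have [d [e [c [cl cc ce]]]] := V_fin.
exists (fun s x => \sum_i eseries (fun k => c i (iter k A x)) s *: e i) => l ll s x.
rewrite linear_sumZ//.
under [X in eseries X]eq_fun => k do rewrite (ce (iter k A x)) linear_sumZ//.
rewrite (_ : (fun k => _) = (fun k => \sum_i l (e i) * c i (iter k A x))); last first.
  by apply/funext => k; apply: eq_bigr => i _; rewrite [LHS]mulrC.
rewrite eseries_sum; last by move=> i; exact: exp_bounded_iter.
by apply: eq_bigr => i _; rewrite [LHS]mulrC.
Qed.

Lemma linear_separates (x y : V) : (forall l : V -> R, linear l -> l x = l y) -> x = y.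
Proof.
have [d [e [c [cl cc ce]]]] := V_fin => xy.
by rewrite (ce x) (ce y); apply: eq_bigr => i _; rewrite (xy (c i)).
Qed.

Variable phi : R -> V -> V.
Hypothesis phiP : is_flow phi.

Lemma flow0 x : phi 0 x = x.
Proof. by apply: linear_separates => l ll; rewrite phiP// eseries0. Qed.

Lemma iter_linear k : linear (iter k A).
Proof. by elim: k => [|k IH] a x y //; rewrite !iterS IH A_linear. Qed.

Lemma flow_linear s : linear (phi s).
Proof.
move=> a x y; apply: linear_separates => l ll.
rewrite ll !phiP//= -[X in _ = X + _]/(_ * _) -eseries_linear; try exact: exp_bounded_iter.
by congr eseries; apply/funext => k; rewrite iter_linear ll.
Qed.

Lemma flow_comm s x : phi s (A x) = A (phi s x).
Proof.
apply: linear_separates => l ll.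
have lAl : linear (l \o A) by move=> a y z; rewrite /= A_linear ll.
rewrite phiP// -[RHS]/((l \o A) _) phiP//.
by congr eseries; apply/funext => k; rewrite /= -iterSr.
Qed.

Lemma is_diff_flow x s : is_diff s (phi ^~ x) (fun v => v *: phi s (A x)).
Proof.
have [d [e [c [cl cc ce]]]] := V_fin.
have H i : is_diff s (fun s => c i (phi s x)) (fun v => v * c i (phi s (A x))).
  rewrite (_ : (fun s => _) = eseries (fun k => c i (iter k A x))).
    have := is_derive_eseries s (exp_bounded_iter x (cl i)).
    move=> /is_derive_is_diff/is_diff_eq; apply; apply/funext => v.
    rewrite phiP//; congr (_ * eseries _ _).
    by apply/funext => k; rewrite -iterSr.
  by apply/funext => s'; rewrite phiP.
rewrite (_ : phi ^~ x = fun s => \sum_i c i (phi s x) *: e i); last first.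
  by apply/funext => s'; rewrite -ce.
have H2 i : is_diff s (fun s => c i (phi s x) *: e i)
    (fun v => (v * c i (phi s (A x))) *: e i) by exact: is_diff_Zl.
have := is_diff_sum H2.
move=> /is_diff_eq; apply; apply/funext => v.
by rewrite [in RHS](ce (phi s (A x))) scaler_sumr; apply: eq_bigr => i _; rewrite scalerA.
Qed.

(** The derivative of a flow curve is again a flow curve, started at [v *: A x]; the induction on
    the order therefore runs over all starting points at once. *)
Lemma smooth_flow_curve x : smooth (phi ^~ x).
Proof.
apply: smoothP => k; elim: k x => [|k IH] x.
  by move=> s _; have [fd _] := is_diff_flow x s; exact: differentiable_continuous.
apply: (Ck_on_is_diff (is_diff_flow x)) => v.
rewrite (_ : (fun s => _) = phi ^~ (v *: A x)); first exact: IH.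
apply/funext => s.
pose F : {linear V -> V} := HB.pack (phi s) (GRing.isLinear.Build _ _ _ _ _ (flow_linear s)).
by rewrite -[RHS]/(F _) linearZ.
Qed.

Lemma flow_coordinates d e c : @frame R V d e c -> forall s x,
  phi s x = \sum_i c i x *: phi s (e i).
Proof. by move=> [_ _ ce] s x; rewrite {1}(ce x) linear_sumZ//; exact: flow_linear. Qed.

(** Linearity in the point separates the variables: a sum of coordinates of [x] times the flow
    curves of the frame vectors. *)
Lemma smooth_flow : smooth (fun sx : R * V => phi sx.1 sx.2).
Proof.
have [d [e [c /[dup] fr [cl cc ce]]]] := V_fin.
under eq_fun do rewrite (flow_coordinates fr).
apply: smooth_sum => i.
apply: (smooth_bilin (b := fun (a : R) (y : V) => a *: y)) => //.
- exact: fin_dim_R.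
- by move=> y a u v; rewrite scalerDl scalerA.
- by move=> a b u v; rewrite scalerDr !scalerA mulrC.
- apply: (smooth_linear_comp (f := @snd R V) (l := c i)) => //.
  apply: smooth_linear; [exact: snd_linear|exact: snd_continuous].
- apply: (smooth_comp_linear (f := phi ^~ (e i)) (l := @fst R V)).
  + exact: fst_linear.
  + exact: fst_continuous.
  + exact: smooth_flow_curve.
Qed.

Lemma flow_invariant (b : V -> V -> R) :
  (forall y, linear (b ^~ y)) -> (forall x, linear (b x)) ->
  (forall x y, b (A x) y + b x (A y) = 0) ->
  forall s x y, b (phi s x) (phi s y) = b x y.
Proof.
move=> bl br bA s x y; rewrite -[in RHS](flow0 x) -[in RHS](flow0 y).
apply: (@is_derive_0_is_cst _ (fun s => b (phi s x) (phi s y))) => {}s.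
have := is_diff_is_derive (1 : R) (is_diff_bilin V_fin V_fin bl br (is_diff_flow x s) (is_diff_flow y s)).
by rewrite !scale1r !flow_comm addrC bA.
Qed.

(** The map [r |-> l (phi (s + s' - r) (phi r x))] has derivative zero; its values at 0 and [s'] are
    the two sides. *)
Lemma flowD s s' x : phi (s + s') x = phi s (phi s' x).
Proof.
apply: linear_separates => l ll.
have [d [e [c /[dup] fr [cl cc ce]]]] := V_fin.
(* In coordinates the two occurrences of [r] become the two factors of a scalar product. *)
pose F (r : R) := \sum_i c i (phi r x) * l (phi (- r + (s + s')) (e i)).
have FE r : F r = l (phi (- r + (s + s')) (phi r x)).
  by rewrite (flow_coordinates fr) linear_sumZ.
have F0 : F 0 = F s'.
  apply: is_derive_0_is_cst => r.
  have lphi t : linear (l \o phi t) by move=> a y z; rewrite /= flow_linear ll.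
  have Nl : linear (-%R : R -> R) by move=> a u v; rewrite opprD scalerN.
  have D1 i : is_diff r (fun r => c i (phi r x)) (fun v => c i (v *: phi r (A x))).
    by apply: is_diff_linear_comp => //; exact: is_diff_flow.
  have D2 i : is_diff r (fun r : R => l (phi (- r + (s + s')) (e i)))
      (fun v : R => l (- v *: phi (- r + (s + s')) (A (e i)))).
    apply: is_diff_linear_comp => //; first exact: fin_dim_linear_continuous.
    by apply: (@is_diff_comp_affine _ _ _ _ (phi ^~ (e i))
      (fun v => v *: phi (- r + (s + s')) (A (e i))) -%R (s + s') r Nl) => //;
      [exact: opp_continuous|exact: is_diff_flow].
  have D i : is_diff r (fun r : R => c i (phi r x) * l (phi (- r + (s + s')) (e i))) _ :=
    is_diffM (D1 i) (D2 i).
  have := is_diff_is_derive (1 : R) (is_diff_sum D).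
  rewrite -[F]/(fun r => \sum_i c i (phi r x) * l (phi (- r + (s + s')) (e i))).
  congr is_derive.
  pose t := - r + (s + s').
  have lA : linear (l \o phi t \o A) by move=> a y z; rewrite /= A_linear flow_linear ll.
  transitivity (- (l \o phi t \o A) (phi r x) + (l \o phi t) (phi r (A x))); last first.
    by rewrite /= (flow_comm r) addNr.
  rewrite [RHS]addrC {2}(ce (phi r (A x))) {2}(ce (phi r x)).
  rewrite (linear_sumZ _ _ (lphi t)) (linear_sumZ _ _ lA).
  rewrite -sumrN -big_split; apply: eq_bigr => i _ /=.
  rewrite !fctE scale1r scaleN1r addrC; congr (_ + _); first exact: mulrC.
  rewrite -scalerN; congr (_ *: _).
  pose L : {linear V -> R} := HB.pack l (GRing.isLinear.Build _ _ _ _ l ll).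
  exact: (linearN L).
by move: F0; rewrite !FE oppr0 add0r flow0 addrCA addNr addr0 => ->.
Qed.

End LinearFlow.

(** * Bilinear forms and the Heisenberg group *)

Section LinearFunctions.
Context (K : pzRingType) (V W : lmodType K) (f : V -> W).
Hypothesis fl : linear f.

Let F : {linear V -> W} := HB.pack f (GRing.isLinear.Build _ _ _ _ f fl).

Lemma lin0 : f 0 = 0. Proof. exact: (linear0 F). Qed.
Lemma linD x y : f (x + y) = f x + f y. Proof. exact: (linearD F). Qed.
Lemma linN x : f (- x) = - f x. Proof. exact: (linearN F). Qed.
Lemma linZ a x : f (a *: x) = a *: f x. Proof. exact: (linearZZ F). Qed.

End LinearFunctions.

Section Bilinear.
Context (K : fieldType) (W : vectType K).

Definition bilinear_form (b : W -> W -> K) :=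
  forall (a : K) u u' w, b (a *: u + u') w = a * b u w + b u' w /\
                         b w (a *: u + u') = a * b w u + b w u'.

Section Form.
Variable b : W -> W -> K.
Hypothesis bb : bilinear_form b.

Lemma form_linearl w : linear (b ^~ w : W -> K^o).
Proof. by move=> a u u'; exact: (bb a u u' w).1. Qed.

Lemma form_linearr w : linear (b w : W -> K^o).
Proof. by move=> a u u'; exact: (bb a u u' w).2. Qed.

Let bl w : {linear W -> K^o} :=
  HB.pack (b ^~ w) (GRing.isLinear.Build _ _ _ _ _ (form_linearl w)).
Let br w : {linear W -> K^o} :=
  HB.pack (b w) (GRing.isLinear.Build _ _ _ _ _ (form_linearr w)).

Lemma formDl u u' w : b (u + u') w = b u w + b u' w.
Proof. exact: (linearD (bl w)). Qed.
Lemma formDr u u' w : b w (u + u') = b w u + b w u'.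
Proof. exact: (linearD (br w)). Qed.
Lemma formZl a u w : b (a *: u) w = a * b u w.
Proof. exact: (linearZZ (bl w)). Qed.
Lemma formZr a u w : b w (a *: u) = a * b w u.
Proof. exact: (linearZZ (br w)). Qed.
Lemma formNl u w : b (- u) w = - b u w.
Proof. exact: (linearN (bl w)). Qed.
Lemma formNr u w : b w (- u) = - b w u.
Proof. exact: (linearN (br w)). Qed.
Lemma form0l w : b 0 w = 0.
Proof. exact: (linear0 (bl w)). Qed.

Lemma form_suml d (k : 'I_d -> K) (e : 'I_d -> W) w :
  b (\sum_i k i *: e i) w = \sum_i k i * b (e i) w.
Proof.
rewrite -[b _ w]/(bl w _) linear_sum; apply: eq_bigr => i _; exact: formZl.
Qed.

Lemma form_sumr d (k : 'I_d -> K) (e : 'I_d -> W) w :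
  b w (\sum_i k i *: e i) = \sum_i k i * b w (e i).
Proof.
rewrite -[b w _]/(br w _) linear_sum; apply: eq_bigr => i _; exact: formZr.
Qed.

Hypothesis b_nondegenerate : forall u, (forall w, b u w = 0) -> u = 0.

Lemma form_inj u v : (forall w, b u w = b v w) -> u = v.
Proof.
move=> uv; apply/eqP; rewrite -subr_eq0; apply/eqP/b_nondegenerate => w.
by rewrite formDl formNl uv subrr.
Qed.

(** Nondegeneracy makes the Gram matrix of a basis invertible, since a row vector in its kernel
    gives the coordinates of a vector orthogonal to everything. Its inverse then yields the
    coordinates of [y]. *)
Lemma form_represents (l : W -> K) : linear (l : W -> K^o) ->
  exists y, forall w, b y w = l w.
Proof.
move=> ll; pose L : {linear W -> K^o} := HB.pack l (GRing.isLinear.Build _ _ _ _ _ ll).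
pose X := vbasis (fullv : {vspace W}).
have XE w : w = \sum_i coord X i w *: X`_i by rewrite [LHS](coord_vbasis (memvf w)).
have /freeP Xfree : free X by apply: basis_free; exact: vbasisP.
pose M : 'M[K]_(\dim (fullv : {vspace W})) := \matrix_(i, j) b X`_i X`_j.
have Mu : M \in unitmx.
  rewrite -row_free_unit -kermx_eq0; apply/rowV0P => x /sub_kermxP xM.
  apply/rowP => i; rewrite mxE; apply: (Xfree (x 0)).
  apply: b_nondegenerate => w; rewrite (XE w) form_sumr big1// => j _.
  have := congr1 (fun A : 'rV[K]_(_) => A 0 j) xM; rewrite !mxE => xMj.
  rewrite form_suml; under eq_bigr => k _.
    rewrite (_ : b _ _ = M k j); last by rewrite mxE.
    over.
  by rewrite xMj mulr0.
pose y := (\row_j l X`_j) *m invmx M.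
exists (\sum_i y 0 i *: X`_i) => w; rewrite -[l w]/(L w) (XE w) form_sumr linear_sum.
apply: eq_bigr => j _; rewrite linearZ /=; congr (_ * _).
rewrite form_suml; transitivity ((y *m M) 0 j).
  by rewrite [RHS]mxE; apply: eq_bigr => i _; rewrite [M _ _]mxE.
by rewrite mulmxKV// mxE.
Qed.

End Form.
End Bilinear.

Section HeisenbergGroup.
Context (R : realType) (n : nat).
Notation V := (heis R n).
Implicit Types (p u w : V).

Lemma heis_fin_dim : fin_dim V.
Proof.
by apply: fin_dim_prod; [apply: fin_dim_prod; exact: fin_dim_rV|exact: fin_dim_R].
Qed.

Lemma heis_bracket_linearl w : linear (fun u => heis_bracket u w).
Proof.
move=> a [[x y] c] [[x' y'] c']; rewrite /heis_bracket /=.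
rewrite !mulmxDl -!scalemxAl !mxE.
by congr (_, _, _); rewrite /= ?scaler0 ?addr0// /GRing.scale/=; ring.
Qed.

Lemma heis_bracketC u w : heis_bracket u w = - heis_bracket w u.
Proof.
case: u w => [[x y] c] [[x' y'] c']; rewrite /heis_bracket /=.
have dotC (v v' : 'rV[R]_n) : (v *m v'^T) 0 0 = (v' *m v^T) 0 0.
  by rewrite -{1}(trmxK v) -trmx_mul mxE.
by rewrite (dotC x) (dotC y); congr (_, _, _); rewrite /= ?oppr0 ?opprB.
Qed.

Lemma heis_bracket_linearr w : linear (heis_bracket w).
Proof.
move=> a u u'; rewrite heis_bracketC heis_bracket_linearl opprD -scalerN.
by rewrite -!heis_bracketC.
Qed.

Lemma heis_bracket0l (w : V) : heis_bracket 0 w = 0.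
Proof. exact: (lin0 (heis_bracket_linearl w)). Qed.

Lemma heis_bracket_central u v w : heis_bracket (heis_bracket u v) w = 0.
Proof.
by rewrite /heis_bracket /= !mul0mx !mxE subrr.
Qed.

Lemma heis_bracketE u w : heis_bracket u w = (heis_bracket u w).2 *: (0, 0, 1).
Proof. by congr (_, _, _); rewrite /= ?scaler0// [RHS]mulr1. Qed.

Lemma heis_centerE (c : V) : heis_center c <-> exists a : R, c = a *: (0, 0, 1).
Proof.
split=> [cP|[a ->] u]; last by rewrite /heis_bracket /= !scaler0 !mul0mx !mxE subrr.
exists c.2; case: c cP => [[x y] a] cP.
have x0 : x = 0.
  (* The bracket with a coordinate vector of the other factor isolates one coordinate. *)
  apply/rowP => i; have := cP (0, delta_mx 0 i, 0) => /(congr1 snd).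
  by rewrite /= trmx0 mulmx0 trmx_delta -colE !mxE subr0.
have y0 : y = 0.
  apply/rowP => i; have := cP (delta_mx 0 i, 0, 0) => /(congr1 snd).
  by rewrite /= trmx0 mulmx0 trmx_delta -colE !mxE sub0r => /eqP; rewrite oppr_eq0 => /eqP.
by rewrite x0 y0; congr (_, _, _); rewrite /= ?scaler0// [RHS]mulr1.
Qed.

(* The differential of the left translation by [a]. *)
Definition translate (a u : V) : V := u + 2^-1 *: heis_bracket a u.

Lemma translate_linear a : linear (translate a).
Proof.
move=> k u w; rewrite /translate heis_bracket_linearr !scalerDr !scalerA.
by rewrite [2^-1 * k]mulrC addrACA; congr (_ + _).
Qed.

Lemma heis_mulE a p : heis_mul a p = translate a p + a.
Proof. by rewrite /heis_mul /translate [RHS]addrC addrA. Qed.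

Lemma is_diff_heis_mul a p : is_diff p (heis_mul a) (translate a).
Proof.
rewrite (_ : heis_mul a = fun p => translate a p + a); last first.
  by apply/funext => q; rewrite heis_mulE.
have lin := translate_linear a.
apply: (is_diff_comp_affine (f := id) (df := id)) => //.
exact: (fin_dim_linear_continuous heis_fin_dim lin).
Qed.

Lemma heis_bracket_centralr u v w : heis_bracket w (heis_bracket u v) = 0.
Proof. by rewrite heis_bracketC heis_bracket_central oppr0. Qed.

Lemma translateD a a' u : translate a (translate a' u) = translate (a + a') u.
Proof.
rewrite /translate (linD (heis_bracket_linearr a)) (linZ (heis_bracket_linearr a)).
rewrite heis_bracket_centralr scaler0 addr0 (linD (heis_bracket_linearl u)) scalerDr.
by rewrite addrAC addrA.
Qed.

Lemma translate_at0 a : translate a 0 = 0.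
Proof. by rewrite /translate (lin0 (heis_bracket_linearr a)) scaler0 addr0. Qed.

Lemma heis_bracket_translatel p u w : heis_bracket (translate p u) w = heis_bracket u w.
Proof.
have := heis_bracket_linearl w 2^-1 (heis_bracket p u) u.
by rewrite heis_bracket_central scaler0 add0r addrC.
Qed.

Lemma heis_bracket_translater p u w : heis_bracket u (translate p w) = heis_bracket u w.
Proof. by rewrite heis_bracketC heis_bracket_translatel -heis_bracketC. Qed.

Lemma translate0 u : translate 0 u = u.
Proof. by rewrite /translate (lin0 (heis_bracket_linearl u)) scaler0 addr0. Qed.

Lemma translateK a : cancel (translate a) (translate (- a)).
Proof. by move=> u; rewrite translateD addNr translate0. Qed.

(** Left translation by [- p] carries [p] to 0, because the bracket of [p] with itself vanishes. *)
Lemma left_invariantE (g : V -> V -> V -> R) : left_invariant g ->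
  forall p u w, g p u w = g 0 (translate (- p) u) (translate (- p) w).
Proof.
move=> gl p u w; have := gl (- p) p u w.
rewrite !(@diff_val _ _ _ _ _ _ _ (is_diff_heis_mul _ _)) heis_mulE.
rewrite /translate (linN (heis_bracket_linearl p)).
rewrite (_ : heis_bracket p p = 0) ?oppr0 ?scaler0 ?addr0 ?subrr //.
have : heis_bracket p p + heis_bracket p p = 0 by rewrite {1}heis_bracketC addNr.
by move=> /eqP; rewrite -mulr2n -scaler_nat scaler_eq0 pnatr_eq0 => /eqP.
Qed.

(** An automorphism intertwines the left translations by [- p] and [- f p], so preserving the scalar
    product at the identity is enough. *)
Lemma automorphism_isometry (g : V -> V -> V -> R) (f f' : V -> V) :
  left_invariant g -> linear f -> linear f' -> cancel f f' -> cancel f' f ->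
  (forall u w, f (heis_bracket u w) = heis_bracket (f u) (f w)) ->
  (forall u w, g 0 (f u) (f w) = g 0 u w) ->
  Defs.isometry g f.
Proof.
move=> gl fl fl' fK fK' fb fg.
have fc := fin_dim_linear_continuous heis_fin_dim fl.
have fc' := fin_dim_linear_continuous heis_fin_dim fl'.
split; first exact: smooth_linear.
  by exists f'; split=> //; exact: smooth_linear.
move=> p u w; rewrite !(@diff_val _ _ _ _ _ _ _ (is_diff_linear p fl fc)).
rewrite !(left_invariantE gl (f p)) (left_invariantE gl p) -[RHS]fg.
have ft v : f (translate (- p) v) = translate (- f p) (f v).
  by rewrite /translate (linD fl) (linZ fl) fb (linN fl).
by rewrite !ft.
Qed.

(** Every element of the transitive group will act in this way. The map is affine, and its inverse
    undoes the translation before the linear map. *)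
Lemma heis_mul_linear_isometry (g : V -> V -> V -> R) (f f' : V -> V) a :
  left_invariant g -> linear f -> linear f' -> cancel f f' -> cancel f' f ->
  Defs.isometry g f -> Defs.isometry g (fun x => heis_mul a (f x)).
Proof.
move=> gl fl fl' fK fK' [_ _ fi].
have fc := fin_dim_linear_continuous heis_fin_dim fl.
pose L x := translate a (f x); pose L' x := f' (translate (- a) x).
have Ll : linear L by move=> k u w; rewrite /L fl translate_linear.
have Ll' : linear L' by move=> k u w; rewrite /L' translate_linear fl'.
have Lc := fin_dim_linear_continuous heis_fin_dim Ll.
have Lc' := fin_dim_linear_continuous heis_fin_dim Ll'.
have E x : heis_mul a (f x) = L x + a by rewrite heis_mulE.
have aN : heis_mul a (- a) = 0 by have := heis_mulN (- a); rewrite opprK.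
have D p : is_diff p (fun x => heis_mul a (f x)) L.
  under eq_fun do rewrite E.
  exact: (is_diff_comp_affine (f := id) (df := id) Ll Lc (is_diff_id _)).
split.
- under eq_fun do rewrite E.
  by apply: smoothD; [exact: smooth_linear|exact: smooth_cst].
- exists (fun x => f' (heis_mul (- a) x)); split=> [|x|x].
  + rewrite (_ : (fun x => _) = fun x => L' x + f' (- a)).
      by apply: smoothD; [exact: smooth_linear|exact: smooth_cst].
    by apply/funext => x; rewrite heis_mulE (linD fl').
  + by rewrite heis_mulA heis_mulN heis_mul0 fK.
  + by rewrite fK' heis_mulA aN heis_mul0.
- move=> p u w; rewrite (diff_valE (D p) u) (diff_valE (D p) w).
  have df v : 'd f p v = f v := diff_valE (is_diff_linear p fl fc) v.
  have dm v : 'd (heis_mul a) (f p) v = translate a v := diff_valE (is_diff_heis_mul a (f p)) v.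
  transitivity (g (f p) (f u) (f w)).
    by rewrite -[RHS](gl a (f p)); congr (g _ _ _); apply/esym; exact: dm.
  by rewrite -[RHS]fi; congr (g _ _ _); apply/esym; exact: df.
Qed.

End HeisenbergGroup.

(** * The Killing equation on the Heisenberg group *)

Section KillingEquations.
Context (R : realFieldType) (V : vectType R).
Variables (z : V) (b om : V -> V -> R) (t : V -> V).
Notation eps := (b z z).
Hypotheses (b_form : bilinear_form b) (om_form : bilinear_form om).
Hypotheses (b_sym : forall u w, b u w = b w u).
Hypotheses (b_nondegenerate : forall u, (forall w, b u w = 0) -> u = 0).
Hypotheses (omC : forall u w, om w u = - om u w).
Hypothesis om_ker : forall u, (forall w, om u w = 0) <-> exists a, u = a *: z.
Hypotheses (eps_neq0 : eps != 0) (tP : forall u w, b (t u) w = eps * om u w).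

Lemma om_z u : om z u = 0 /\ om u z = 0.
Proof.
have H : forall w, om z w = 0 by apply/om_ker; exists 1; rewrite scale1r.
by split; rewrite // omC H oppr0.
Qed.

Lemma skew_t u w : b (t u) w = - b u (t w).
Proof. by rewrite [in RHS]b_sym !tP omC mulrN. Qed.

Lemma perp_t u : b z (t u) = 0.
Proof. by rewrite b_sym tP (om_z u).2 mulr0. Qed.

(** The square of [t] is self-adjoint for [b]. Together with the antisymmetry of [om] this says that
    [t] is skew for [om], that is, a derivation of the Heisenberg algebra. *)
Lemma om_t u w : om (t u) w = om (t w) u.
Proof.
by apply: (mulfI eps_neq0); rewrite -!tP (skew_t (t u)) (skew_t (t w)) b_sym.
Qed.

Lemma om_uu u : om u u = 0.
Proof. have := omC u u; lra. Qed.

Lemma ker_t u : t u = 0 -> exists a, u = a *: z.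
Proof.
move=> tu0; apply/om_ker => w; apply: (mulfI eps_neq0).
by rewrite -tP tu0 (form0l b_form) mulr0.
Qed.

(** [S] stands for the smooth functions and [E u] for the derivation along the left-invariant field
    of [u]. Linearity and the commutation rule are all that is assumed of [E], which makes the rest
    of the argument algebraic. *)
Variables (S : (V -> R) -> Prop) (E : V -> (V -> R) -> V -> R).
Hypothesis E_S : forall u F, S F -> S (E u F).
Hypothesis ED : forall u F G p, S F -> S G ->
  E u (fun x => F x + G x) p = E u F p + E u G p.
Hypothesis EZ : forall u a F p, S F -> E u (fun x => a * F x) p = a * E u F p.
Hypothesis E_bracket : forall u w F p, S F ->
  E u (E w F) p - E w (E u F) p = om u w * E z F p.
Hypothesis S_Z : forall a F, S F -> S (fun x => a * F x).
Hypothesis S_D : forall F G, S F -> S G -> S (fun x => F x + G x).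

(* [h w] is the scalar product with [w] of a Killing field, trivialised by the
   left translations; [K1]-[K3] are the components of the Killing equation. *)
Variable h : V -> V -> R.
Hypothesis h_S : forall w, S (h w).
Hypothesis h_linear : forall a u w p, h (a *: u + w) p = a * h u p + h w p.
Hypothesis K1 : forall p, E z (h z) p = 0.
Hypothesis K2 : forall u p, b z u = 0 -> E u (h z) p + E z (h u) p = - h (t u) p.
Hypothesis K3 : forall u w p, b z u = 0 -> b z w = 0 ->
  E u (h w) p + E w (h u) p = 0.

Let E0 u p : E u (fun=> 0) p = 0.
Proof.
rewrite (_ : (fun=> 0) = (fun x => 0 * h z x)); first by rewrite EZ// mul0r.
by apply/funext => x; rewrite mul0r.
Qed.

Let E_z_comm u F p : S F -> E z (E u F) p = E u (E z F) p.
Proof.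
by move=> FS; apply/eqP; rewrite -subr_eq0 E_bracket// (om_z u).1 mul0r.
Qed.

Let EN u F p : S F -> E u (fun x => - F x) p = - E u F p.
Proof.
move=> FS; rewrite -[RHS]mulN1r -EZ//; congr E; apply/funext => x.
by rewrite mulN1r.
Qed.

Let P u w y p := E u (E w (h y)) p.
Let k y p := E z (h y) p.

Let P_skew u w y p : b z w = 0 -> b z y = 0 -> P u w y p = - P u y w p.
Proof.
move=> w0 y0; rewrite /P -EN; last exact: E_S.
congr E; apply/funext => x; have := K3 x w0 y0; lra.
Qed.

Let P_bracket u w y p : P u w y p - P w u y p = om u w * k y p.
Proof. exact: E_bracket. Qed.

(* As in Koszul's formula, the cyclic commutators determine [P], which is skew
   in its last two arguments. *)
Let PE u w y p : b z u = 0 -> b z w = 0 -> b z y = 0 ->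
  P u w y p = (om u w * k y p + om y u * k w p - om w y * k u p) / 2.
Proof.
move=> u0 w0 y0.
have := P_bracket u w y p; have := P_bracket w y u p; have := P_bracket y u w p.
have := P_skew u p w0 y0; have := P_skew w p u0 y0; have := P_skew y p u0 w0.
lra.
Qed.

(** Applying [E z] to [K3] and eliminating [E z (h _)] by [K2] gives the sum of both orders of
    derivation. Their difference is [om u w * E z (h z)], zero by [K1], so each order is half of the
    sum. *)
Let EEf u w p : b z u = 0 -> b z w = 0 ->
  E u (E w (h z)) p = - (E u (h (t w)) p + E w (h (t u)) p) / 2.
Proof.
move=> u0 w0.
have Ef x : b z x = 0 -> forall q, E z (h x) q = - h (t x) q - E x (h z) q.
  by move=> x0 q; have := K2 q x0; lra.
have ZE x y : b z y = 0 -> E z (E x (h y)) p = - E x (h (t y)) p - E x (E y (h z)) p.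
  move=> y0; rewrite E_z_comm//.
  rewrite (_ : E z (h y) = fun q => - h (t y) q + - E y (h z) q); last first.
    by apply/funext => q; rewrite Ef.
  have SN F : S F -> S (fun x => - F x).
    by move=> FS; under eq_fun do rewrite -mulN1r; exact: S_Z.
  by rewrite ED ?EN//; [exact: E_S|exact: SN|apply: SN; exact: E_S].
have : E z (E u (h w)) p = - E z (E w (h u)) p.
  rewrite -EN; last exact: E_S.
  congr E; apply/funext => x; have := K3 x u0 w0; lra.
rewrite !ZE//.
have := E_bracket u w p (h_S z); rewrite K1 mulr0.
lra.
Qed.

(* [E v] and [E u] commute on [E w (h z)], because [E z (h z) = 0]. *)
Let P_sym u v w p : b z u = 0 -> b z v = 0 -> b z w = 0 ->
  P v u (t w) p + P v w (t u) p = P u v (t w) p + P u w (t v) p.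
Proof.
move=> u0 v0 w0.
have EE x y : b z y = 0 -> E x (E y (E w (h z))) p = - (P x y (t w) p + P x w (t y) p) / 2.
  move=> y0; rewrite (_ : E y (E w (h z)) = fun q => - 2^-1 * (E y (h (t w)) q + E w (h (t y)) q)).
    rewrite EZ ?ED//; try (by apply: E_S); last by apply: S_D; exact: E_S.
    rewrite /P; lra.
  by apply/funext => q; rewrite EEf//; lra.
have := E_bracket v u p (E_S w (h_S z)).
rewrite E_z_comm// (_ : E z (h z) = fun=> 0) ?E0; last by apply/funext => x; exact: K1.
rewrite !EE//; lra.
Qed.

Lemma t_addz a w : t (a *: z + w) = t w.
Proof.
apply: (form_inj b_form b_nondegenerate) => y.
by rewrite !tP (om_form a z w y).1 (om_z y).1 mulr0 add0r.
Qed.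

(** In [P_sym] take [t w'] for [u] and [w'] for the other two vectors. By [PE] and the symmetries of
    [om] only [om (t w') w' * k (t w') p = 0] survives, and [b (t w') (t w')] is a multiple of that
    first factor. *)
Let k_t_nonnull w p : b (t w) (t w) * k (t w) p = 0.
Proof.
(* [t] does not see the component along [z], so [w] may be replaced by its part orthogonal to
   [z]. *)
suff H w' : b z w' = 0 -> b (t w') (t w') * k (t w') p = 0.
  have := H (- (b z w / b z z) *: z + w); rewrite t_addz; apply.
  by rewrite (b_form _ z w z).2 mulNr divfK// addNr.
move=> w0.
have := P_sym p (perp_t w') w0 w0.
rewrite !PE// ?perp_t//.
rewrite (omC (t (t w')) w') (om_t (t w')) !om_uu (omC (t w') w').
have -> : b (t w') (t w') = - b z z * om (t w') w'.
  by rewrite mulNr -tP (skew_t (t w')) opprK.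
move: (om (t w') w') (k (t w') p) => x y H.
rewrite -mulrA (_ : x * y = 0) ?mulr0//; lra.
Qed.

Let k_linear p : linear (k ^~ p : V -> R^o).
Proof.
move=> a u w; rewrite /k -[X in _ = X + _]/(a * _) -EZ// -ED//; last exact: S_Z.
by congr E; apply/funext => x; rewrite h_linear.
Qed.

(* [k o t] vanishes on the non-null vectors of [t], a dense set. *)
Let k_t w p : k (t w) p = 0.
Proof.
have kD x y := linD (k_linear p) x y.
have kN x := linN (k_linear p) x.
have tD u v : t (u + v) = t u + t v.
  apply: (form_inj b_form b_nondegenerate) => y.
  by rewrite (formDl b_form) !tP (formDl om_form) mulrDr.
have tN u : t (- u) = - t u.
  apply: (form_inj b_form b_nondegenerate) => y.
  by rewrite (formNl b_form) !tP (formNl om_form) mulrN.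
(* If every [t v] is null, polarisation makes the image of [t] totally isotropic. Then [t (t w) = 0]
   by skewness, so [t w] is a multiple of [z] that is orthogonal to [z], hence zero. *)
have [[w0 w0P]|null] := pselect (exists w0, b (t w0) (t w0) != 0); last first.
  suff -> : t w = 0 by exact: (lin0 (k_linear p)).
  have tt0 x y : b (t x) (t y) = 0.
    have q0 v : b (t v) (t v) = 0.
      by apply/eqP/negP => /negP q; apply: null; exists v.
    have := q0 (x + y); rewrite tD (formDl b_form) !(formDr b_form) !q0.
    rewrite (b_sym (t y)); lra.
  have [a] : exists a, t w = a *: z.
    apply: ker_t; apply: b_nondegenerate => y; by rewrite skew_t tt0 oppr0.
  move=> twa; have := perp_t w; rewrite twa (formZr b_form).
  by move/eqP; rewrite mulf_eq0 (negPf eps_neq0) orbF => /eqP ->; rewrite scale0r.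
have kw0 : k (t w0) p = 0.
  by have /eqP := k_t_nonnull w0 p; rewrite mulf_eq0 (negPf w0P) => /eqP.
(* In the sum of the two relations the cross terms [b (t w) (t w0)] cancel, which leaves twice
   [b (t w0) (t w0) * k (t w) p]. *)
have := k_t_nonnull (w + w0) p; have := k_t_nonnull (w - w0) p.
rewrite !tD tN !kD kN kw0 oppr0 !addr0.
rewrite !(formDl b_form) !(formDr b_form) !(formNl b_form) !(formNr b_form).
rewrite !mulrDl k_t_nonnull (b_sym (t w0)) => H1 H2.
have /eqP : b (t w0) (t w0) * k (t w) p = 0 by lra.
by rewrite mulf_eq0 (negPf w0P) => /eqP.
Qed.

Lemma killing_solution p :
  [/\ forall u, b z u = 0 -> E z (h u) p = 0,
      forall u, b z u = 0 -> E u (h z) p = - h (t u) p &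
      forall u w, b z u = 0 -> b z w = 0 -> E u (h (t w)) p = E w (h (t u)) p].
Proof.
have kz u q : b z u = 0 -> E z (h u) q = 0.
  move=> u0.
  (* The vector representing [k] is orthogonal to the image of [t], hence killed by [t], hence a
     multiple of [z]; so [k] vanishes on the orthogonal of [z]. *)
  have [x xP] := form_represents b_form b_nondegenerate (k_linear q).
  have /ker_t[a xa] : t x = 0.
    by apply: b_nondegenerate => w; rewrite skew_t xP k_t oppr0.
  by rewrite -[LHS]/(k u q) -xP xa (formZl b_form) u0 mulr0.
have Ef u q : b z u = 0 -> E u (h z) q = - h (t u) q.
  by move=> u0; rewrite -K2// kz// addr0.
split=> [u|u|u w u0 w0]; [exact: kz|exact: Ef|].
(* Once [E w (h z)] is known to be [- h (t w)], this says that [E u (h (t w))] is the mean of itself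
   and its exchange. *)
have := EEf p u0 w0.
rewrite (_ : E w (h z) = fun q => - h (t w) q) ?EN//; first lra.
by apply/funext => q; exact: Ef.
Qed.

End KillingEquations.

(** * Derivations along left-invariant fields *)

Section InvariantDerivation.
Context (R : realType) (n : nat).
Notation V := (heis R n).
Variables (z : V) (om : V -> V -> R).
Hypothesis om_bilinear : bilinear_form om.
Hypothesis bracketE : forall u w : V, heis_bracket u w = om u w *: z.
Hypothesis omC : forall u w, om w u = - om u w.
Hypothesis om_z : forall u, om z u = 0 /\ om u z = 0.
Implicit Types (F G : V -> R) (p u w : V).

(* Derivation along the left-invariant vector field of [u]. *)
Definition inv_deriv u F p := 'd F p (translate p u).

Notation E := inv_deriv.

Lemma inv_derivE u F p : E u F p = 'd F p u + 2^-1 * om p u * 'd F p z.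
Proof.
rewrite /E /translate bracketE linearD scalerA linearZ.
by congr (_ + _).
Qed.

Lemma inv_deriv_z F p : E z F p = 'd F p z.
Proof. by rewrite inv_derivE (om_z p).2 mulr0 mul0r addr0. Qed.

Lemma inv_deriv0 u F : E u F 0 = 'd F 0 u.
Proof. by rewrite /E translate0. Qed.

Let half_om_linear u : linear (fun p => 2^-1 * om p u : R^o).
Proof. by move=> a p q; rewrite (om_bilinear a p q u).1 mulrDr mulrCA. Qed.

Let half_om_continuous u : continuous (fun p => 2^-1 * om p u).
Proof. exact: (fin_dim_linear_continuous (@heis_fin_dim R n) (half_om_linear u)). Qed.

Lemma smooth_inv_deriv u F : smooth F -> smooth (E u F).
Proof.
move=> Fs; rewrite (_ : E u F = fun p => 'd F p u + 2^-1 * om p u * 'd F p z); last first.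
  by apply/funext => p; rewrite inv_derivE.
apply: smoothD; first exact: smooth_diff.
apply: smoothM; last exact: smooth_diff.
exact: (smooth_linear (half_om_linear u)).
Qed.

Lemma inv_derivD u F G p : smooth F -> smooth G ->
  E u (fun x => F x + G x) p = E u F p + E u G p.
Proof.
move=> Fs Gs; rewrite /E.
have := is_diffD (differentiableP (smooth_differentiable p Fs))
                 (differentiableP (smooth_differentiable p Gs)).
by move=> H; exact: (diff_valE H).
Qed.

Lemma inv_derivZ u a F p : smooth F -> E u (fun x => a * F x) p = a * E u F p.
Proof.
move=> Fs; rewrite /E.
have := is_diffZ a (differentiableP (smooth_differentiable p Fs)).
by move=> H; exact: (diff_valE H).
Qed.

(** Second-order terms cancel by Schwarz's theorem. Differentiating the coefficient [2^-1 * om p _]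
    leaves one half of [om u w] from each order, and the two halves add up. *)
Lemma inv_deriv_bracket u w F p : smooth F ->
  E u (E w F) p - E w (E u F) p = om u w * E z F p.
Proof.
move=> Fs.
have D u' w' : E u' (E w' F) p =
    'd (fun x => 'd F x w') p u' + 2^-1 * om u' w' * 'd F p z
    + 2^-1 * om p w' * 'd (fun x => 'd F x z) p u'
    + 2^-1 * om p u' * ('d (fun x => 'd F x w') p z
       + 2^-1 * om p w' * 'd (fun x => 'd F x z) p z).
  pose dE (v : V) := 'd (fun x => 'd F x w') p v +
      (2^-1 * om p w' * 'd (fun x => 'd F x z) p v + 'd F p z * (2^-1 * om v w')).
  have H : is_diff p (E w' F) dE.
    rewrite (_ : E w' F = (fun p => 'd F p w') + (fun p => 2^-1 * om p w') * (fun p => 'd F p z)); last first.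
      by apply/funext => x; rewrite inv_derivE.
    apply: is_diffD.
      by apply: differentiableP; apply: smooth_differentiable; exact: smooth_diff.
    apply: is_diffM.
      exact: (is_diff_linear p (half_om_linear w')).
    by apply: differentiableP; apply: smooth_differentiable; exact: smooth_diff.
  transitivity (dE u' + 2^-1 * om p u' * dE z).
    by rewrite inv_derivE; congr (_ + _ * _); exact: diff_valE H _.
  rewrite /dE (om_z w').1.
  have alg (a b c d e x y t h : R) : a + (h * x * b + c * (h * y)) +
    h * t * (d + (h * x * e + c * (h * 0))) = a + h * y * c + h * x * b + h * t * (d + h * x * e).
    by ring.
  exact: alg.
have alg (a a' c d d' e e' f x y t t' : R) : a = a' -> d = d' -> e = e' -> t' = - t ->
    a + 2^-1 * t * c + 2^-1 * x * d + 2^-1 * y * (e + 2^-1 * x * f)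
   - (a' + 2^-1 * t' * c + 2^-1 * y * e' + 2^-1 * x * (d' + 2^-1 * y * f)) = t * c.
  by move=> -> -> -> ->; field.
rewrite (D u w) (D w u) inv_deriv_z.
apply: alg (omC u w); [exact: schwarz|exact: schwarz|].
by apply/esym; exact: schwarz.
Qed.

End InvariantDerivation.

(** * The isotropy algebra *)

Lemma schwarz_fin_dim (R : realType) (V W : normedModType R) (F : V -> W) p u w :
  fin_dim W -> smooth F ->
  'd (fun x => 'd F x u) p w = 'd (fun x => 'd F x w) p u.
Proof.
move=> Wf Fs; apply: (linear_separates Wf) => l ll.
have lc := fin_dim_linear_continuous Wf ll.
have dl (G : V -> W) : smooth G -> forall x v, 'd (fun y => l (G y)) x v = l ('d G x v).
  move=> Gs x v; apply: (diff_valE (is_diff_linear_comp ll lc _)).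
  by apply: differentiableP; exact: smooth_differentiable.
have lFs := smooth_linear_comp ll lc Fs.
have := schwarz p u w lFs.
rewrite (_ : (fun x => 'd _ x u) = (fun x => l ('d F x u))); last first.
  by apply/funext => x; exact: dl.
rewrite (_ : (fun x => 'd _ x w) = (fun x => l ('d F x w))); last first.
  by apply/funext => x; exact: dl.
move=> H; rewrite -(dl (fun x => 'd F x u)); last exact: smooth_diff.
by rewrite H dl//; exact: smooth_diff.
Qed.

Section LeftInvariantMetric.
Context (R : realType) (n : nat).
Notation V := (heis R n).
Variables (g : V -> V -> V -> R) (z : V).
Hypothesis g_metric : pseudo_riemannian_metric g.
Hypothesis g_left : left_invariant g.
Hypothesis center_nondegenerate : forall c : V, heis_center c ->
  (forall c' : V, heis_center c' -> g 0 c c' = 0) -> c = 0.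
Hypothesis zP : @heis_center R n = [set a *: z | a in setT].

Notation b := (g 0).

Lemma metric_form p : bilinear_form (g p).
Proof.
have [gl gC _ _] := g_metric.
by move=> a u u' w; split; [exact: gl|rewrite gC gl !(gC _ w)].
Qed.

Lemma metric_sym p u w : g p u w = g p w u.
Proof. by have [_ ->] := g_metric. Qed.

Lemma metric_nondegenerate p u : (forall w, g p u w = 0) -> u = 0.
Proof. by have [_ _ + _] := g_metric; apply. Qed.

Lemma centerP c : heis_center c <-> exists a, c = a *: z.
Proof.
rewrite zP; split=> [[a _ <-]|[a ->]]; first by exists a.
by exists a.
Qed.

Lemma center_z : heis_center z.
Proof. by apply/centerP; exists 1; rewrite scale1r. Qed.

Lemma z_2neq0 : z.2 != 0.
Proof.
have /centerP[a] : heis_center ((0, 0, 1) : V).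
  by apply/heis_centerE; exists 1; rewrite scale1r.
move=> /(congr1 snd) /= H; apply/eqP => z0.
by move: H; rewrite z0 [_ *: _]mulr0 => /eqP; rewrite oner_eq0.
Qed.

(** The coefficient of the bracket along [z]. As [z] may be any generator of the center, its last
    coordinate has to be divided out. *)
Definition om (u w : V) : R := (heis_bracket u w).2 / z.2.

Lemma bracketE u w : heis_bracket u w = om u w *: z.
Proof.
have /heis_centerE[a za] := center_z.
have a0 : a != 0 by have := z_2neq0; rewrite za /= [_ *: _]mulr1.
rewrite heis_bracketE /om {2}za scalerA za /= [a *: 1]mulr1.
by rewrite divfK.
Qed.

Lemma om_form : bilinear_form om.
Proof.
move=> a u u' w; rewrite /om heis_bracket_linearl heis_bracket_linearr.
have H (p q : V) : (a *: p + q).2 / z.2 = a * (p.2 / z.2) + q.2 / z.2.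
  by rewrite mulrA -mulrDl.
by split; exact: H.
Qed.

Lemma om_anti u w : om w u = - om u w.
Proof. by rewrite /om heis_bracketC /= mulNr. Qed.

Lemma om_kernel u : (forall w, om u w = 0) <-> exists a, u = a *: z.
Proof.
rewrite -centerP; split=> [H w|H w]; first by rewrite bracketE H scale0r.
by rewrite /om H mul0r.
Qed.

Lemma bzz_neq0 : b z z != 0.
Proof.
apply/eqP => bzz; have := z_2neq0.
rewrite (center_nondegenerate center_z) ?eqxx// => c' /centerP[a ->].
by rewrite (formZr (metric_form 0)) bzz mulr0.
Qed.

(** Here [t] is an endomorphism of the whole algebra: it kills [z] and takes values orthogonal to
    [z], so it restricts to the map on the complement. *)
Lemma exists_t : exists t : V -> V, forall u w, b (t u) w = b z (heis_bracket u w).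
Proof.
suff /choice[t tP] : forall u, exists y, forall w, b y w = b z (heis_bracket u w).
  by exists t => u w; exact: tP.
move=> u; apply: (form_represents (metric_form 0) (@metric_nondegenerate 0)).
move=> a w w'; rewrite heis_bracket_linearr (formDr (metric_form 0)).
by rewrite (formZr (metric_form 0)).
Qed.

Variable t : V -> V.
Hypothesis tP : forall u w, b (t u) w = b z (heis_bracket u w).

Lemma t_om u w : b (t u) w = b z z * om u w.
Proof. by rewrite tP bracketE (formZr (metric_form 0)) mulrC. Qed.

Let ob := om_form.
Let bb := metric_form 0.
Let bS := metric_sym 0.
Let bN := @metric_nondegenerate 0.
Let Oz := om_z om_anti om_kernel.

Section Isotropy.
Variable phi : R -> V -> V.
Hypothesis phi_smooth : smooth (fun sx : R * V => phi sx.1 sx.2).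
Hypothesis phiD : forall s s' x, phi (s + s') x = phi s (phi s' x).
Hypothesis phi_isometry : forall s, Defs.isometry g (phi s).

Let Phi := fun sx : R * V => phi sx.1 sx.2.

Let xi x := 'd Phi (0, x) (1, 0).

(** [phi 0] is injective, and the group law at 0 + 0 makes it idempotent. *)
Let phi0 x : phi 0 x = x.
Proof.
have [_ [f [_ fK _]] _] := phi_isometry 0.
by apply: (can_inj fK); rewrite -phiD addr0.
Qed.

Let pairl : linear (fun x : V => (0, x) : R * V).
Proof. by move=> a u v; congr pair; rewrite /= scaler0 addr0. Qed.

Let pairl_continuous : continuous (fun x : V => (0, x) : R * V).
Proof. exact: (fin_dim_linear_continuous (@heis_fin_dim R n) pairl). Qed.

Let xi_smooth : smooth xi.
Proof.
by apply: (smooth_comp_linear pairl pairl_continuous (f := fun y => 'd Phi y (1, 0)));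
  exact: smooth_diff.
Qed.

Let d_phi s p u : 'd (phi s) p u = 'd Phi (s, p) (0, u).
Proof.
have H : is_diff ((0, p) + (s, 0)) Phi ('d Phi (s, p)).
  rewrite (_ : _ + _ = (s, p)); last by congr pair; rewrite /= ?add0r ?addr0.
  by apply: differentiableP; exact: smooth_differentiable.
have := is_diff_comp_affine pairl pairl_continuous H.
rewrite (_ : (fun y => _) = phi s); first by move/diff_valE; apply.
by apply/funext => y; rewrite /Phi /= add0r addr0.
Qed.

Let d_curve (W : normedModType R) (F : R * V -> W) p : smooth F ->
  is_diff (0 : R) (fun s : R => F (s, p)) (fun v => v *: 'd F (0, p) (1, 0)).
Proof.
move=> Fs; apply: is_derive_is_diff.
have := is_derive_line ((0, p) : R * V) ((1, 0) : R * V) (0 : R) Fs.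
rewrite (_ : (fun s : R => _) = fun s => F (s, p)); last first.
  apply/funext => s; congr F; congr pair; rewrite /= ?scaler0 ?add0r// addr0.
  exact: mulr1.
by rewrite scale0r add0r.
Qed.

Let d_phi_curve p : is_diff (0 : R) (phi ^~ p) (fun v => v *: xi p).
Proof. exact: (d_curve p phi_smooth). Qed.

(** Schwarz's theorem exchanges the time derivative with the differential in space. *)
Let d_dphi_curve p u :
  is_diff (0 : R) (fun s => 'd (phi s) p u) (fun v => v *: 'd xi p u).
Proof.
have := d_curve p (smooth_diff (0, u) phi_smooth).
rewrite (_ : (fun s : R => _) = (fun s => 'd (phi s) p u)); last first.
  by apply/funext => s; rewrite d_phi.
rewrite schwarz_fin_dim//; last exact: heis_fin_dim.
suff E : 'd xi p u = 'd (fun x => 'd Phi x (1, 0)) (0, p) (0, u).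
  by move/is_diff_eq; apply; apply/funext => v; congr (_ *: _); exact/esym.
have H : is_diff ((0, p) : R * V) (fun x => 'd Phi x (1, 0))
    ('d (fun x => 'd Phi x (1, 0)) (0, p)).
  by apply: differentiableP; apply: smooth_differentiable; exact: smooth_diff.
have H0 : is_diff ((0, p) + 0 : R * V) (fun x => 'd Phi x (1, 0))
    ('d (fun x => 'd Phi x (1, 0)) (0, p)) by rewrite addr0.
have := is_diff_comp_affine pairl pairl_continuous H0.
rewrite (_ : (fun y => _) = xi); first by move/diff_valE => dxi; exact: dxi.
by apply/funext => x; rewrite addr0.
Qed.

(** The bilinear correction in [translate (- q) u = u + beta q u], isolated so that the Leibniz rule
    applies to it. *)
Let beta (q u : V) := 2^-1 *: heis_bracket (- q) u.

Let betaN q u : beta q u = - (2^-1 *: heis_bracket q u).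
Proof. by rewrite /beta (linN (heis_bracket_linearl u)) scalerN. Qed.

Let beta_l u : linear (beta ^~ u).
Proof.
move=> a q q'; rewrite !betaN heis_bracket_linearl scalerDr opprD scalerN !scalerA.
by rewrite [2^-1 * a]mulrC.
Qed.

Let beta_r q : linear (beta q).
Proof.
move=> a u u'; rewrite !betaN heis_bracket_linearr scalerDr opprD scalerN !scalerA.
by rewrite [2^-1 * a]mulrC.
Qed.

Let Vf : fin_dim V := @heis_fin_dim R n.

(** The velocity at time 0 of [moved p u], the image of [u] under the flow brought back to the
    identity by left translation. *)
Let delta p u := 'd xi p u + (beta p ('d xi p u) + beta (xi p) u).

Let d_phi0 p u : 'd (phi 0) p u = u.
Proof.
rewrite (_ : phi 0 = id); last by apply/funext => x; exact: phi0.
exact: (diff_valE (is_diff_id p)).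
Qed.

Let moved p u s := translate (- phi s p) ('d (phi s) p u).

Let d_moved p u : is_diff (0 : R) (moved p u) (fun v => v *: delta p u).
Proof.
have D := is_diff_bilin Vf Vf beta_l beta_r (d_phi_curve p) (d_dphi_curve p u).
have := is_diffD (d_dphi_curve p u) D.
move=> /is_diff_eq; apply; apply/funext => v.
have alg (q c U : V) : q = p -> U = u -> v *: c + (beta q (v *: c) + beta (v *: xi p) U) =
    v *: (c + (beta p c + beta (xi p) u)).
  by move=> -> ->; rewrite (linZ (beta_r p)) (linZ (beta_l u)) !scalerDr.
exact: alg (phi0 p) (d_phi0 p u).
Qed.

Let moved0 p u : moved p u 0 = translate (- p) u.
Proof. by rewrite /moved phi0; congr translate; exact: d_phi0. Qed.

(** The scalar product at the identity of the transported vectors is [g p u w] at all times, so its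
    derivative vanishes. *)
Let killing_equation p u w :
  b (translate (- p) u) (delta p w) + b (delta p u) (translate (- p) w) = 0.
Proof.
have bl y : linear (b ^~ y : V -> R) by exact: form_linearl.
have br y : linear (b y : V -> R) by exact: form_linearr.
have D := is_diff_bilin Vf Vf bl br (d_moved p u) (d_moved p w).
have := is_diff_is_derive (1 : R) D.
rewrite !scale1r !moved0 => -[_ <-].
rewrite (_ : (fun s : R => _) = cst (g p u w)); first exact: derive_cst.
apply/funext => s; rewrite -(left_invariantE g_left).
by have [_ _ ->] := phi_isometry s.
Qed.

(* The infinitesimal isometry [xi] in the left trivialisation. *)
Let h w p := b (translate (- p) (xi p)) w.

Let h_smooth w : smooth (h w).
Proof.
have bl : linear (b ^~ w : V -> R) by exact: form_linearl.
apply: (smooth_linear_comp bl (fin_dim_linear_continuous Vf bl)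
  (f := fun p => xi p + beta p (xi p))).
apply: smoothD => //; apply: (smooth_bilin Vf Vf beta_l beta_r) => //.
exact: smooth_id.
Qed.

Let d_h w p v : 'd (h w) p v = b ('d xi p v + (beta p ('d xi p v) + beta v (xi p))) w.
Proof.
have bl : linear (b ^~ w : V -> R) by exact: form_linearl.
have xid : is_diff p xi ('d xi p).
  by apply: differentiableP; exact: smooth_differentiable.
have D := is_diffD xid (is_diff_bilin Vf Vf beta_l beta_r (is_diff_id p) xid).
exact: (diff_valE (is_diff_linear_comp bl (fin_dim_linear_continuous Vf bl) D)).
Qed.

Notation E := (@inv_deriv R n).

(** Differentiating the trivialisation in [h] produces [beta v (xi p)] where [delta] has
    [beta (xi p) v]. The two differ by a bracket, which is the term in [b z w]. *)
Let E_h u w p : E u (h w) p =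
  b (delta p (translate p u)) w - om u (translate (- p) (xi p)) * b z w.
Proof.
rewrite /inv_deriv d_h /delta.
set v := translate p u.
have bC : beta v (xi p) = beta (xi p) v - heis_bracket u (translate (- p) (xi p)).
  rewrite !betaN (heis_bracketC (xi p)) scalerN opprK.
  have <- : heis_bracket v (xi p) = heis_bracket u (translate (- p) (xi p)).
    by rewrite heis_bracket_translatel heis_bracket_translater.
  move: (heis_bracket v (xi p)) => x.
  by rewrite -{3}[x]scale1r -scalerBl -scaleNr; congr (_ *: _); field.
by rewrite bC addrA addrA (formDl bb) (formNl bb) bracketE (formZl bb) -!addrA.
Qed.

(** The Killing equation on the left-invariant fields of [u] and [w]. Taking each of them equal or
    orthogonal to [z] gives [K1], [K2] and [K3]. *)
Let K p u w : E u (h w) p + E w (h u) p +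
  (om u (translate (- p) (xi p)) * b z w + om w (translate (- p) (xi p)) * b z u) = 0.
Proof.
have := killing_equation p (translate p u) (translate p w).
rewrite !translateK !E_h (bS u); lra.
Qed.

Hypothesis phi_fix : forall s, phi s 0 = 0.
Variable A : {linear V -> V}.
Hypothesis phi_A : forall u, is_derive (0 : R) (1 : R) (fun s => 'd (phi s) 0 u) (A u).

Let is_derive_unique (f : R -> V) (x y : V) :
  is_derive (0 : R) (1 : R) f x -> is_derive (0 : R) (1 : R) f y -> x = y.
Proof. by move=> [_ <-] [_ <-]. Qed.

Let xi0 : xi 0 = 0.
Proof.
have := is_diff_is_derive (1 : R) (d_phi_curve 0); rewrite scale1r.
rewrite (_ : (fun s : R => _) = cst 0); last by apply/funext => s; exact: phi_fix.
by move=> /is_derive_unique; apply; exact: is_derive_cst.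
Qed.

Let dxi0 u : 'd xi 0 u = A u.
Proof.
apply: is_derive_unique (phi_A u).
by have := is_diff_is_derive (1 : R) (d_dphi_curve 0 u); rewrite scale1r.
Qed.

Let E0 u w : E u (h w) 0 = b (A u) w.
Proof.
rewrite inv_deriv0 d_h xi0; congr (b _ w).
rewrite (lin0 (beta_r u)) addr0 [beta 0 _](lin0 (beta_l _)) addr0.
exact: dxi0.
Qed.

Let h0 w : h w 0 = 0.
Proof.
by rewrite /h xi0 translate_at0 (form0l bb).
Qed.

Lemma isotropy_infinitesimal :
  [/\ A z = 0,
      forall u, b z u = 0 -> b z (A u) = 0,
      forall u w, b z u = 0 -> b z w = 0 -> b (A u) w = - b u (A w) &
      forall u, b z u = 0 -> A (t u) = t (A u)].
Proof.
have K1 p : E z (h z) p = 0.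
  by have := K p z z; rewrite (Oz _).1 mul0r; lra.
have K2 u p : b z u = 0 -> E u (h z) p + E z (h u) p = - h (t u) p.
  have ht : h (t u) p = b z z * om u (translate (- p) (xi p)) by rewrite /h bS t_om.
  by move=> u0; have := K p u z; rewrite u0 ht; lra.
have K3 u w p : b z u = 0 -> b z w = 0 -> E u (h w) p + E w (h u) p = 0.
  by move=> u0 w0; have := K p u w; rewrite u0 w0; lra.
have hl a u w p : h (a *: u + w) p = a * h u p + h w p.
  by rewrite /h (bb a u w _).2.
have [] := killing_solution bb ob bS bN om_anti om_kernel bzz_neq0 t_om
  (S := @smooth R V R) (@smooth_inv_deriv R n z om ob bracketE)
  (@inv_derivD R n) (@inv_derivZ R n)
  (inv_deriv_bracket ob bracketE om_anti Oz) _ (@smoothD R V R) h_smooth hl K1 K2 K3 0.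
  by move=> a F Fs; apply: smoothM => //; exact: smooth_cst.
move=> S1 S2 S3.
have decompose w : exists a w', b z w' = 0 /\ w = a *: z + w'.
  exists (b z w / b z z), (w - (b z w / b z z) *: z); split; last by rewrite addrC subrK.
  by rewrite (formDr bb) (formNr bb) (formZr bb) divfK ?subrr// bzz_neq0.
have Az : A z = 0.
  apply: bN => w; have [a [w' [w0 ->]]] := decompose w.
  by rewrite (bb a z w' _).2 -!E0 K1 S1// mulr0 addr0.
have zA u : b z u = 0 -> b z (A u) = 0.
  by move=> u0; rewrite bS -E0 S2// h0 oppr0.
have skewA u w : b z u = 0 -> b z w = 0 -> b (A u) w = - b u (A w).
  move=> u0 w0; have := K3 u w 0 u0 w0; rewrite !E0 (bS u); lra.
split=> // u u0; apply: (form_inj bb bN) => w.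
have zt v : b z (t v) = 0 by exact: (perp_t bS om_anti om_kernel t_om v).
have [a [w' [w0 ->]]] := decompose w.
rewrite !(bb a z w' _).2 !(bS _ z) zA// zt; congr (_ + _).
(* At the fixed point [E u (h w)] is [b (A u) w], so the symmetry [S3] exchanges [b (A w') (t u)]
   with [b (A u) (t w')]; skewness of [A] and of [t] does the rest. *)
rewrite skewA// (bS _ (A w')) -E0 -S3// E0.
by rewrite (skew_t bS om_anti t_om (A u)).
Qed.

End Isotropy.

(** * Flows of skew derivations *)

Section SkewDerivation.
Variables (D : V -> V) (phi : R -> V -> V).
Hypotheses (D_linear : linear D) (phiP : is_flow D phi) (Dz : D z = 0).
Hypothesis D_skew : forall u w, b (D u) w + b u (D w) = 0.
Hypothesis D_om : forall u w, om (D u) w + om u (D w) = 0.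

Let Vf : fin_dim V := @heis_fin_dim R n.

Lemma flow_center s : phi s z = z.
Proof.
apply: (linear_separates Vf) => l ll.
rewrite -[in RHS](flow0 Vf phiP z).
apply: (@is_derive_0_is_cst _ (fun s => l (phi s z))) => {}s.
have lc := fin_dim_linear_continuous Vf ll.
have := is_diff_is_derive (1 : R)
  (is_diff_linear_comp ll lc (is_diff_flow Vf D_linear phiP z s)).
by rewrite Dz scale1r (lin0 (flow_linear Vf D_linear phiP s)) (lin0 ll).
Qed.

Lemma flow_form s u w : b (phi s u) (phi s w) = b u w.
Proof.
by apply: (flow_invariant Vf D_linear phiP (b := b)) => // y;
  [exact: form_linearl|exact: form_linearr].
Qed.

Lemma flow_bracket s u w : phi s (heis_bracket u w) = heis_bracket (phi s u) (phi s w).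
Proof.
rewrite !bracketE (linZ (flow_linear Vf D_linear phiP s)) flow_center.
congr (_ *: _); apply/esym.
by apply: (flow_invariant Vf D_linear phiP (b := om)) => // y;
  [exact: form_linearl|exact: form_linearr].
Qed.

Lemma flowK s : cancel (phi s) (phi (- s)).
Proof. by move=> x; rewrite -(flowD Vf D_linear phiP) addNr (flow0 Vf phiP). Qed.

(** Serves twice: with [D] equal to [t] for the transitive group, and with an element of the
    centralizer of [t] for the isotropy algebra. *)
Lemma flow_isometry s : Defs.isometry g (phi s).
Proof.
apply: (automorphism_isometry (f' := phi (- s)) g_left).
- exact: (flow_linear Vf D_linear phiP s).
- exact: (flow_linear Vf D_linear phiP (- s)).
- exact: flowK.
- by move=> x; rewrite -[s in phi s]opprK flowK.
- exact: flow_bracket.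
- exact: flow_form.
Qed.

End SkewDerivation.

Let t_linear : linear t.
Proof.
move=> a u w; apply: (form_inj bb bN) => y.
by rewrite (bb a _ _ y).1 !t_om (ob a u w y).1; ring.
Qed.

Lemma t_z : t z = 0.
Proof. by apply: bN => w; rewrite t_om (Oz _).1 mulr0. Qed.

Lemma perp_decomposition w : exists a w', b z w' = 0 /\ w = a *: z + w'.
Proof.
exists (b z w / b z z), (w - (b z w / b z z) *: z); split; last by rewrite addrC subrK.
by rewrite (formDr bb) (formNr bb) (formZr bb) divfK ?subrr// bzz_neq0.
Qed.

Lemma isotropy_converse (A : {linear V -> V}) :
  A z = 0 ->
  (forall u, b z u = 0 -> b z (A u) = 0) ->
  (forall u w, b z u = 0 -> b z w = 0 -> b (A u) w = - b u (A w)) ->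
  (forall u, b z u = 0 -> A (t u) = t (A u)) ->
  isotropy_lie_algebra g 0 A.
Proof.
move=> Az zA A_skew At.
have A_linear : linear A by move=> a u w; rewrite linearD linearZ.
have AE a u : A (a *: z + u) = A u by rewrite A_linear Az scaler0 add0r.
have Vf : fin_dim V := @heis_fin_dim R n.
have D_skew u w : b (A u) w + b u (A w) = 0.
  have [a [u' [u0 ->]]] := perp_decomposition u.
  have [c [w' [w0 ->]]] := perp_decomposition w.
  rewrite !AE (bb a z u' (A w')).1 (bb c z w' (A u')).2 (bS _ z) !zA//.
  by rewrite A_skew// !mulr0 !add0r addNr.
have At' u : A (t u) = t (A u).
  have [a [u' [u0 ->]]] := perp_decomposition u.
  by rewrite AE t_linear t_z scaler0 add0r At.
(* Since [b z z * om u w] is [b (t u) w], commuting with [t] turns skewness for [b] into skewness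
   for [om]. *)
have D_om u w : om (A u) w + om u (A w) = 0.
  apply: (mulfI bzz_neq0); rewrite mulrDr -!t_om mulr0 -At'; exact: D_skew.
have [phi phiP] := flow_exists Vf A_linear.
exists phi; split.
- exact: (smooth_flow Vf A_linear phiP).
- exact: (flowD Vf A_linear phiP).
- move=> s; split; first exact: (flow_isometry A_linear phiP Az D_skew D_om s).
  exact: (lin0 (flow_linear Vf A_linear phiP s)).
- move=> u; rewrite (_ : (fun s => _) = phi ^~ u); last first.
    apply/funext => s; have fl := flow_linear Vf A_linear phiP s.
    exact: (diff_valE (is_diff_linear 0 fl (fin_dim_linear_continuous Vf fl))).
  have := is_diff_is_derive (1 : R) (is_diff_flow Vf A_linear phiP u 0).
  by rewrite scale1r (flow0 Vf phiP).
Qed.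

(** * Restriction to the orthogonal complement of the center *)

Section Subspace.
Variable v : {vspace V}.
Hypothesis vP : forall u : V, u \in v <-> b z u = 0.

Let B (u w : subvs_of v) := b (vsval u) (vsval w).

Let perpP (u : subvs_of v) : b z (vsval u) = 0.
Proof. by apply/vP; exact: subvsP. Qed.

Let perpK u : b z u = 0 -> vsval (vsproj v u) = u.
Proof. by move=> /vP u0; rewrite vsprojK. Qed.

Let B_inj (u w : subvs_of v) : (forall y, B u y = B w y) -> u = w.
Proof.
move=> uw; apply: val_inj; apply: (form_inj bb bN) => y.
have [a [y' [y0 ->]]] := perp_decomposition y.
rewrite !(bb a z y' _).2 !(bS _ z) !perpP; congr (_ + _).
by have := uw (vsproj v y'); rewrite /B perpK.
Qed.

(** The compression of [f] to [v]; it agrees with [f] at vectors that [f] keeps orthogonal to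
    [z]. *)
Let End_of (f : V -> V) (fl : linear f) : 'End(subvs_of v) :=
  let F : {linear V -> V} := HB.pack f (GRing.isLinear.Build _ _ _ _ f fl) in
  linfun (vsproj v \o F \o vsval).

Let End_ofE f (fl : linear f) (u : subvs_of v) : b z (f (vsval u)) = 0 ->
  vsval (End_of fl u) = f (vsval u).
Proof. by move=> fu; rewrite lfunE /= perpK. Qed.

Let is_t (t' : 'End(subvs_of v)) := forall u w : subvs_of v,
  B (t' u) w = b z (heis_bracket (vsval u) (vsval w)).

Let is_tP t' : is_t t' -> forall u, vsval (t' u) = t (vsval u).
Proof.
move=> t'P u; have tu0 := perp_t bS om_anti om_kernel t_om (vsval u).
rewrite -(perpK tu0); congr vsval; apply: B_inj => w.
by rewrite t'P -tP /B perpK.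
Qed.

Let skew_u u w : b (t u) w = - b u (t w) := skew_t bS om_anti t_om u w.

Lemma isotropy_subspace :
  (exists! t' : 'End(subvs_of v), is_t t') /\
  forall t' : 'End(subvs_of v), is_t t' ->
    skew_adjoint B t' /\
    isotropy_lie_algebra g 0 =
      [set A : {linear V -> V} |
        exists2 C : 'End(subvs_of v), centralizer (skew_adjoint B) t' C &
          A z = 0 /\ forall u : subvs_of v, A (vsval u) = vsval (C u)].
Proof.
have tperp u := perp_t bS om_anti om_kernel t_om u.
split.
  exists (End_of t_linear); split=> [u w|t' t'P].
    by rewrite /B End_ofE// tP.
  apply/lfunP => u; apply: val_inj; rewrite /= (is_tP t'P).
  by rewrite -[LHS]/(vsval _) End_ofE.
move=> t' t'P; split.
  by move=> u w; rewrite /B !(is_tP t'P) skew_u.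
apply/seteqP; split=> [A [phi [phi_smooth phiD phi_iso phi_A]]|A [C [Cskew Ct] [Az AC]]].
- have [Az zA A_skew At] := isotropy_infinitesimal phi_smooth phiD
    (fun s => (phi_iso s).1) (fun s => (phi_iso s).2) phi_A.
  have A_linear : linear A by move=> a u w; rewrite linearD linearZ.
  have CE (u : subvs_of v) : vsval (End_of A_linear u) = A (vsval u).
    by apply: End_ofE; exact: zA.
  exists (End_of A_linear); last by split=> // u; rewrite CE.
  split; first by move=> u w; rewrite /B !CE A_skew.
  apply/lfunP => u; apply: val_inj; rewrite !comp_lfunE -[LHS]/(vsval _) -[RHS]/(vsval _).
  by rewrite CE !(is_tP t'P) CE At.
- have AvE u : b z u = 0 -> A u = vsval (C (vsproj v u)).
    by move=> u0; rewrite -AC perpK.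
  apply: isotropy_converse => // [u u0|u w u0 w0|u u0].
  + by rewrite AvE.
  + by have := Cskew (vsproj v u) (vsproj v w); rewrite /B !perpK// !AvE.
  + have := congr1 (fun F : 'End(subvs_of v) => vsval (F (vsproj v u))) Ct.
    by rewrite !comp_lfunE -AC !(is_tP t'P) perpK// -AvE.
Qed.

End Subspace.
End LeftInvariantMetric.

(** * The group of left translations and rotations *)

Section SemidirectProduct.
Context (R : realType) (n : nat).
Notation V := (heis R n).
Variable phi : R -> V -> V.
Hypothesis phi_smooth : forall x, smooth (phi ^~ x).
Hypothesis phi0 : forall x, phi 0 x = x.
Hypothesis phiD : forall s s' x, phi (s + s') x = phi s (phi s' x).
Hypothesis phi_linear : forall s, linear (phi s).
Hypothesis phi_bracket : forall s u w,
  phi s (heis_bracket u w) = heis_bracket (phi s u) (phi s w).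
(* The one-parameter group [phi] may be periodic: the group below is the
   quotient of [V >< R] that acts effectively. *)
Variable r : R.
Hypothesis r_gt0 : 0 < r.
Hypothesis phi_small : forall s, `|s| < r + r -> (forall x, phi s x = x) -> s = 0.

(** Keeping the map [phi s] and forgetting [s] is what forms the quotient: parameters that differ by
    a period give equal elements. *)
Record semidirect := Semidirect {
  pt : V;
  rot : V -> V;
  rotP : exists s, rot = phi s }.

Lemma semidirect_eq (a a' : semidirect) : pt a = pt a' -> rot a = rot a' -> a = a'.
Proof.
case: a a' => [p f fP] [p' f' fP'] /= E E'; subst p' f'.
by congr Semidirect; exact: Prop_irrelevance.
Qed.

HB.instance Definition _ := gen_eqMixin semidirect.
HB.instance Definition _ := gen_choiceMixin semidirect.

Definition mk p s : semidirect := @Semidirect p (phi s) (ex_intro _ s erefl).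

Lemma mkP a : exists p s, a = mk p s.
Proof.
by case: (rotP a) => s fs; exists (pt a), s; exact: semidirect_eq.
Qed.

(** An arbitrary choice of parameter; only [phi (angle a)] is intrinsic, so operations defined
    through it are compared after applying [phi]. *)
Definition angle a : R := sval (cid (rotP a)).

Lemma angleE a : a = mk (pt a) (angle a).
Proof. by apply: semidirect_eq => //=; exact: svalP (cid (rotP a)). Qed.

Lemma rot_angle a : phi (angle a) = rot a.
Proof. by rewrite [in RHS](angleE a). Qed.

Lemma angle_mk p s : phi (angle (mk p s)) = phi s.
Proof. exact: rot_angle. Qed.

Definition sd_mul a a' := mk (heis_mul (pt a) (rot a (pt a'))) (angle a + angle a').
Definition sd_inv a := mk (phi (- angle a) (- pt a)) (- angle a).

Lemma phi_mul s p q : phi s (heis_mul p q) = heis_mul (phi s p) (phi s q).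
Proof.
by rewrite /heis_mul !(linD (phi_linear s)) (linZ (phi_linear s)) phi_bracket.
Qed.

Lemma mk_mul p s p' s' : sd_mul (mk p s) (mk p' s') = mk (heis_mul p (phi s p')) (s + s').
Proof.
apply: semidirect_eq => //=; apply/funext => x.
by rewrite !phiD !angle_mk.
Qed.

Lemma phiN_eq s s' : phi s = phi s' -> phi (- s) = phi (- s').
Proof.
move=> ss'; apply/funext => x.
rewrite -[x in RHS](phi0 x) -(subrr s) phiD ss' -phiD addNr phi0.
by [].
Qed.

Lemma mk_inv p s : sd_inv (mk p s) = mk (- phi (- s) p) (- s).
Proof.
by apply: semidirect_eq; rewrite /= (phiN_eq (angle_mk p s))// (linN (phi_linear _)).
Qed.

Lemma sd_mulA : associative sd_mul.
Proof.
move=> a a' a''; have [p [s ->]] := mkP a; have [p' [s' ->]] := mkP a'.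
have [p'' [s'' ->]] := mkP a''.
by rewrite !mk_mul phi_mul heis_mulA phiD addrA.
Qed.

Lemma sd_mul1 : left_id (mk 0 0) sd_mul.
Proof. by move=> a; have [p [s ->]] := mkP a; rewrite mk_mul phi0 heis_mul0 add0r. Qed.

Lemma heis_mul_0 (p : V) : heis_mul p 0 = p.
Proof. by rewrite heis_mulE translate_at0 add0r. Qed.

Lemma sd_1mul : right_id (mk 0 0) sd_mul.
Proof.
by move=> a; have [p [s ->]] := mkP a; rewrite mk_mul (lin0 (phi_linear s)) heis_mul_0 addr0.
Qed.

Lemma sd_mulV : left_inverse (mk 0 0) sd_inv sd_mul.
Proof.
by move=> a; have [p [s ->]] := mkP a; rewrite mk_inv mk_mul heis_mulN addNr.
Qed.

Lemma sd_Vmul : right_inverse (mk 0 0) sd_inv sd_mul.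
Proof.
move=> a; have [p [s ->]] := mkP a; rewrite mk_inv mk_mul (linN (phi_linear s)) -phiD subrr phi0.
by have := heis_mulN (- p); rewrite opprK => ->.
Qed.

HB.instance Definition _ := isGroup.Build semidirect sd_mulA sd_mul1 sd_1mul sd_mulV sd_Vmul.

(** * Charts and the Lie group structure *)

Section Charts.
Variables (d : nat) (psi : V * R -> 'rV[R]_d) (psi' : 'rV[R]_d -> V * R).
Hypotheses (psi_linear : linear psi) (psi'_linear : linear psi').
Hypotheses (psiK : cancel psi psi') (psi'K : cancel psi' psi).

Definition sd_dom s0 : set semidirect :=
  [set a | exists s, `|s - s0| < r /\ rot a = phi s].

Definition local_angle s0 a : R := xget 0 [set s | `|s - s0| < r /\ rot a = phi s].

(** The angle ranges over an open interval of radius [r] around [s0]. The topology is thus that of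
    the parameter and not that of the maps [phi s], and a dense winding still gives a line. *)
Definition sd_chart s0 : chart R semidirect d :=
  Chart (sd_dom s0) (fun a => psi (pt a, local_angle s0 a))
        (fun y => mk (psi' y).1 (psi' y).2).

Lemma local_angleP s0 a : sd_dom s0 a ->
  `|local_angle s0 a - s0| < r /\ rot a = phi (local_angle s0 a).
Proof. by move=> H; exact: (xgetPex 0 H). Qed.

(** Two angles of one element in the same chart differ by less than [r + r], so [phi_small]
    identifies them. *)
Lemma local_angle_mk s0 p s : `|s - s0| < r -> local_angle s0 (mk p s) = s.
Proof.
move=> ss0.
have [H1 H2] : `|local_angle s0 (mk p s) - s0| < r /\ phi s = phi (local_angle s0 (mk p s)).
  by apply: local_angleP; exists s.
apply/eqP; rewrite -subr_eq0; apply/eqP; apply: phi_small => [|x].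
  by rewrite -(subrKA s0) (le_lt_trans (ler_normD _ _))// ltrD// distrC.
by rewrite addrC phiD -H2 -phiD addNr phi0.
Qed.

Let Vf : fin_dim V := @heis_fin_dim R n.
Let Wf : fin_dim (V * R)%type := fin_dim_prod Vf (fin_dim_R R).
Let psi_c := fin_dim_linear_continuous Wf psi_linear.

(* Near [u] the local angle differs from [th] by a constant period of [phi]. *)
Lemma near_local_angle (U : normedModType R) (a : U -> V) (th : U -> R) s0 u :
  continuous th -> sd_dom s0 (mk (a u) (th u)) ->
  exists dl, \forall v \near u, sd_dom s0 (mk (a v) (th v)) /\
    local_angle s0 (mk (a v) (th v)) = th v + dl.
Proof.
move=> thc udom; have [H1 H2] := local_angleP udom.
pose dl := local_angle s0 (mk (a u) (th u)) - th u.
have dlP x : phi dl x = x.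
  by rewrite /dl addrC phiD -H2 -phiD addNr phi0.
exists dl.
have : \forall v \near u, `|th v + dl - s0| < r.
  have c : {for u, continuous (fun v => th v + (dl - s0))}.
    by apply: (@continuousD _ _ _ th (cst _)); [exact: thc|exact: cst_continuous].
  have : `|th u + (dl - s0)| < r.
    have -> // : th u + (dl - s0) = local_angle s0 (mk (a u) (th u)) - s0.
    by rewrite /dl; ring.
  move/(cvgr_norm_lt (th u + (dl - s0)) c).
  by apply: filterS => v; rewrite /= addrA.
apply: filterS => v vr.
have -> : mk (a v) (th v) = mk (a v) (th v + dl).
  by apply: semidirect_eq => //=; apply/funext => x; rewrite phiD dlP.
by split; [exists (th v + dl)|rewrite local_angle_mk].
Qed.

(** Transition maps, product, inverse and one-parameter subgroups all have the form
    [mk (a u) (th u)] with [a] and [th] globally smooth. In a chart this is locally [psi] of [a] and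
    [th] shifted by a constant. *)
Lemma smooth_on_chart (U : normedModType R) (O : set U) (a : U -> V) (th : U -> R) s0 :
  open O -> smooth a -> smooth th ->
  smooth_on [set u | O u /\ sd_dom s0 (mk (a u) (th u))]
    (fun u => cmap (sd_chart s0) (mk (a u) (th u))).
Proof.
move=> oO asm thsm; have thc := smooth_continuous thsm.
apply: smooth_on_near.
  rewrite openE => u [uO udom].
  have [dl H] := near_local_angle thc udom.
  have uO' : \forall v \near u, O v by apply: open_nbhs_nbhs.
  by apply: filterS2 uO' H => v vO [].
move=> u [uO udom]; have [dl H] := near_local_angle thc udom.
exists (fun v => psi (a v, th v + dl)).
  apply: (smooth_linear_comp psi_linear psi_c (f := fun v => (a v, th v + dl))).
  by apply: smooth_pair => //; apply: smoothD => //; exact: smooth_cst.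
by apply: filterS H => v [_ E]; rewrite /= E.
Qed.

Definition sd_atlas : set (chart R semidirect d) := [set sd_chart s0 | s0 in setT].

Lemma near_norm_lt (U W : normedModType R) (F : U -> W) (e : R) (u : U) (Q : U -> Prop) :
  continuous F -> `|F u| < e -> (forall v, `|F v| < e -> Q v) ->
  \forall v \near u, Q v.
Proof.
move=> Fc Fu FQ.
have H : \forall v \near u, `|F v| < e by exact: (cvgr_norm_lt (F u) (Fc u) e Fu).
by apply: filterS H => v; exact: FQ.
Qed.

Lemma open_norm_lt (U W : normedModType R) (F : U -> W) (e : R) :
  continuous F -> open [set u | `|F u| < e].
Proof.
by move=> Fc; rewrite openE => u /= Fu; exact: (cvgr_norm_lt (F u) (Fc u) e Fu).
Qed.

Lemma sd_image s0 (Q : set semidirect) :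
  cmap (sd_chart s0) @` (cdom (sd_chart s0) `&` Q) =
  [set y | `|(psi' y).2 - s0| < r /\ Q (mk (psi' y).1 (psi' y).2)].
Proof.
apply/seteqP; split=> [y [a [adom Qa] <-]|y [ys Qy]] /=.
  have [H1 H2] := local_angleP adom.
  rewrite psiK /=; split=> //.
  by rewrite (_ : mk _ _ = a)//; exact: semidirect_eq.
exists (mk (psi' y).1 (psi' y).2); last by rewrite local_angle_mk//= -surjective_pairing psi'K.
by split=> //; exists (psi' y).2.
Qed.

Lemma crangeE s0 : crange (sd_chart s0) = [set y | `|(psi' y).2 - s0| < r].
Proof.
by rewrite /crange -[cdom _]setIT sd_image; apply/seteqP; split=> [y []|y] //.
Qed.

Let psi'1_linear : linear (fun y => (psi' y).1).
Proof. by move=> a u v; rewrite psi'_linear. Qed.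

Let psi'2_linear : linear (fun y => (psi' y).2).
Proof. by move=> a u v; rewrite psi'_linear. Qed.

Let psi'1_c := fin_dim_linear_continuous (fin_dim_rV R d) psi'1_linear.
Let psi'2_c := fin_dim_linear_continuous (fin_dim_rV R d) psi'2_linear.
Let psi'1_smooth := smooth_linear psi'1_linear psi'1_c.
Let psi'2_smooth := smooth_linear psi'2_linear psi'2_c.

Lemma open_crange s0 : open (crange (sd_chart s0)).
Proof.
rewrite crangeE; apply: (open_norm_lt (F := fun y => (psi' y).2 - s0)).
apply: (smooth_continuous (f := fun y => (psi' y).2 - s0)).
by apply: smoothB => //; exact: smooth_cst.
Qed.

Lemma eq_smooth_on (U W : normedModType R) (O O' : set U) (f f' : U -> W) :
  smooth_on O f -> O = O' -> f = f' -> smooth_on O' f'.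
Proof. by move=> fs <- <-. Qed.

Lemma smooth_heis_mul (U : normedModType R) (a a' : U -> V) : smooth a -> smooth a' ->
  smooth (fun u => heis_mul (a u) (a' u)).
Proof.
move=> sa sa'; apply: smoothD; first exact: smoothD.
apply: (smooth_bilin (b := fun u w : V => 2^-1 *: heis_bracket u w)) => //.
- by move=> w c u u'; rewrite heis_bracket_linearl scalerDr !scalerA mulrC.
- by move=> w c u u'; rewrite heis_bracket_linearr scalerDr !scalerA mulrC.
Qed.

Lemma smooth_phi_linear (U : normedModType R) (th : U -> R) (a : U -> V) :
  linear th -> continuous th -> smooth a -> smooth (fun u => phi (th u) (a u)).
Proof.
move=> thl thc sa; have [k [e [c [cl cc ce]]]] := Vf.
have E u : phi (th u) (a u) = \sum_i c i (a u) *: phi (th u) (e i).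
  by rewrite {1}(ce (a u)) linear_sumZ.
under eq_fun do rewrite E.
apply: smooth_sum => i.
apply: (smooth_bilin (b := fun (x : R) (y : V) => x *: y)) => //.
- exact: fin_dim_R.
- by move=> y x u v; rewrite scalerDl scalerA.
- by move=> x y u v; rewrite scalerDr !scalerA mulrC.
- exact: (smooth_linear_comp (cl i) (cc i)).
- exact: (smooth_comp_linear (f := phi ^~ (e i)) thl thc).
Qed.

Lemma sd_atlasP : smooth_atlas sd_atlas.
Proof.
split.
- by move=> _ a [s0 _ <-] adom /=; rewrite psiK /=; apply: semidirect_eq => //=;
    have [] := local_angleP adom.
- move=> _ _ [s0 _ <-] [s1 _ <-].
  apply: (eq_smooth_on (smooth_on_chart s1 (@open_crange s0) psi'1_smooth psi'2_smooth)) => //.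
  by rewrite sd_image crangeE.
(* The centers run through the integer multiples of [r], nonnegative ones at even [i] and
   nonpositive ones at odd [i]. *)
- exists (fun i => sd_chart ((-1) ^+ i * (i./2)%:R * r)); split=> [i|a].
    by exists ((-1) ^+ i * (i./2)%:R * r).
  (* Rounding [|s| / r] down puts [|s|] at distance less than [r] from [m * r]. *)
  pose s := angle a; pose m := Num.truncn (`|s| / r).
  have mP : `| `|s| - m%:R * r| < r.
    have /andP[m1 m2] : (m%:R <= `|s| / r < m.+1%:R).
      by apply: Num.Theory.truncn_itv; rewrite divr_ge0// ltW.
    rewrite ler_pdivlMr// in m1; rewrite ltr_pdivrMr// -natr1 mulrDl mul1r in m2.
    by rewrite ger0_norm ?subr_ge0// ltrBlDl.
  exists (if 0 <= s then m.*2 else m.*2.+1); exists s; split; last by rewrite rot_angle.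
  case: (lerP 0 s) => s0.
    by rewrite doubleK -signr_odd odd_double expr0 mul1r -[s in s - _]ger0_norm.
  rewrite /= uphalf_double -signr_odd /= odd_double expr1.
  have -> : s - -1 * m%:R * r = - (`|s| - m%:R * r) by rewrite ltr0_norm//; ring.
  by rewrite normrN.
- move=> a a' aa'.
  (* A continuous function with distinct values separates: the preimages of the balls with radius
     half the distance are disjoint. *)
  have sep (F : semidirect -> V) : (continuous (fun y => F (mk (psi' y).1 (psi' y).2))) ->
      F a <> F a' -> exists O O' : set semidirect,
        [/\ atlas_open sd_atlas O, atlas_open sd_atlas O', O a, O' a' & O `&` O' = set0].
    move=> Fc Faa'; pose e := `|F a - F a'| / 2.
    have e0 : 0 < e by rewrite divr_gt0// normr_gt0 subr_eq0; exact/eqP.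
    have oQ x : atlas_open sd_atlas [set q | `|F q - x| < e].
      move=> _ [s0 _ <-]; rewrite sd_image.
      rewrite (_ : [set y | _] = crange (sd_chart s0) `&` 
          [set y | `|F (mk (psi' y).1 (psi' y).2) - x| < e]); last by rewrite crangeE.
      apply: openI; first exact: open_crange.
      apply: (open_norm_lt (F := fun y => F (mk (psi' y).1 (psi' y).2) - x)) => y.
      by apply: continuousB; [exact: Fc|exact: cst_continuous].
    exists [set q | `|F q - F a| < e], [set q | `|F q - F a'| < e]; split=> //=.
    + by rewrite subrr normr0.
    + by rewrite subrr normr0.
    + apply/seteqP; split=> // q [/= q1 q2].
      have : `|F a - F a'| < e + e.
        apply: (le_lt_trans (ler_distD (F q) _ _)); apply: ltrD; last exact: q2.
        by rewrite distrC; exact: q1.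
      by rewrite -splitr ltxx.
  (* Distinct elements differ in their point, or else their rotations differ at some [x], and both
     data depend continuously on the element. *)
  have [pp|pp] := pselect (pt a = pt a'); last exact: sep pp.
  have [x xP] : exists x, rot a x <> rot a' x.
    apply: contrapT => H; apply: aa'; apply: semidirect_eq => //; apply/funext => x.
    by apply: contrapT => Hx; apply: H; exists x.
  apply: (sep (fun a => rot a x)) => //=.
  by apply: smooth_continuous; exact: (smooth_comp_linear (f := phi ^~ x)).
Qed.

Lemma mulE p s p' s' : (mk p s * mk p' s')%g = mk (heis_mul p (phi s p')) (s + s').
Proof. exact: mk_mul. Qed.

Lemma invE p s : (mk p s)^-1%g = mk (- phi (- s) p) (- s).
Proof. exact: mk_inv. Qed.

Lemma oneE : 1%g = mk 0 0 :> semidirect.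
Proof. by []. Qed.

Lemma sd_mul_smooth c1 c2 c3 : sd_atlas c1 -> sd_atlas c2 -> sd_atlas c3 ->
  smooth_on
    [set p : 'rV[R]_d * 'rV[R]_d |
      [/\ crange c1 p.1, crange c2 p.2 & cdom c3 (cinv c1 p.1 * cinv c2 p.2)%g]]
    (fun p => cmap c3 (cinv c1 p.1 * cinv c2 p.2)%g).
Proof.
move=> [s1 _ <-] [s2 _ <-] [s3 _ <-].
pose O := [set p : 'rV[R]_d * 'rV[R]_d | crange (sd_chart s1) p.1 /\ crange (sd_chart s2) p.2].
have oO : open O.
  apply: (@openI _ (fst @^-1` crange (sd_chart s1)) (snd @^-1` crange (sd_chart s2))).
    by apply: open_comp => [y _|]; [exact: fst_continuous|exact: open_crange].
  by apply: open_comp => [y _|]; [exact: snd_continuous|exact: open_crange].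
pose th (p : 'rV[R]_d * 'rV[R]_d) := (psi' p.1).2 + (psi' p.2).2.
pose a (p : 'rV[R]_d * 'rV[R]_d) := heis_mul (psi' p.1).1 (phi (psi' p.1).2 (psi' p.2).1).
have f1l : linear (@fst 'rV[R]_d 'rV[R]_d) by exact: fst_linear.
have f2l : linear (@snd 'rV[R]_d 'rV[R]_d) by exact: snd_linear.
have f1c : continuous (@fst 'rV[R]_d 'rV[R]_d) by exact: fst_continuous.
have f2c : continuous (@snd 'rV[R]_d 'rV[R]_d) by exact: snd_continuous.
have ths : smooth th.
  by apply: smoothD; [exact: (smooth_comp_linear f1l f1c psi'2_smooth)|
                      exact: (smooth_comp_linear f2l f2c psi'2_smooth)].
have as_ : smooth a.
  apply: smooth_heis_mul; first exact: (smooth_comp_linear f1l f1c psi'1_smooth).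
  apply: (smooth_phi_linear (th := fun p => (psi' p.1).2)).
  - by move=> k u v; rewrite /= psi'_linear.
  - exact: (smooth_continuous (smooth_comp_linear f1l f1c psi'2_smooth)).
  - exact: (smooth_comp_linear f2l f2c psi'1_smooth).
have E p : (cinv (sd_chart s1) p.1 * cinv (sd_chart s2) p.2)%g = mk (a p) (th p).
  by rewrite /= mulE.
apply: (eq_smooth_on (smooth_on_chart s3 oO as_ ths)).
  apply/seteqP; split=> p; rewrite /= mulE; first by case=> -[].
  by case.
by apply/funext => p; rewrite E.
Qed.

Lemma sd_inv_smooth c1 c2 : sd_atlas c1 -> sd_atlas c2 ->
  smooth_on [set p | crange c1 p /\ cdom c2 (cinv c1 p)^-1%g]
    (fun p => cmap c2 (cinv c1 p)^-1%g).
Proof.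
move=> [s1 _ <-] [s2 _ <-].
have Nl : linear (fun y => - (psi' y).2).
  by move=> k u v; rewrite psi'2_linear opprD scalerN.
have ths : smooth (fun y => - (psi' y).2) by exact: smoothN.
have as_ : smooth (fun y => - phi (- (psi' y).2) (psi' y).1).
  apply: smoothN; apply: (smooth_phi_linear Nl) => //.
  exact: smooth_continuous.
apply: (eq_smooth_on (smooth_on_chart s2 (@open_crange s1) as_ ths)).
  by apply/seteqP; split=> p /=; rewrite invE.
by apply/funext => p; congr cmap; rewrite -invE.
Qed.

Definition sd_lie : lieGroup R :=
  @LieGroup R semidirect d sd_atlas sd_atlasP sd_mul_smooth sd_inv_smooth.

Definition sd_act (a : sd_lie) (x : V) : V := heis_mul (pt a) (rot a x).

Lemma sd_actE p s x : sd_act (mk p s) x = heis_mul p (phi s x).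
Proof. by []. Qed.

Lemma sd_smooth_action : smooth_action sd_act.
Proof.
split=> [x|a a' x|c [s0 _ <-]].
- by rewrite /sd_act /= phi0 heis_mul0.
- have [p [s ->]] := mkP a; have [p' [s' ->]] := mkP a'.
  by rewrite /sd_act mulE /= phiD phi_mul heis_mulA.
- apply: smooth_on_near => [|u _].
    apply: (@open_comp _ _ fst (crange (sd_chart s0))) => [y _|].
      exact: fst_continuous.
    exact: open_crange.
  have f1l : linear (@fst 'rV[R]_d V) by exact: fst_linear.
  have f1c : continuous (@fst 'rV[R]_d V) by exact: fst_continuous.
  exists (fun p : 'rV[R]_d * V => sd_act (cinv (sd_chart s0) p.1) p.2); last by apply: filterE => y.
  apply: smooth_heis_mul; first exact: (smooth_comp_linear f1l f1c psi'1_smooth).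
  apply: (smooth_phi_linear (th := fun p => (psi' p.1).2)).
  - by move=> k x y; rewrite /= psi'_linear.
  - exact: (smooth_continuous (smooth_comp_linear f1l f1c psi'2_smooth)).
  - by apply: smooth_linear; [exact: snd_linear|exact: snd_continuous].
Qed.

Lemma sd_transitive x y : exists a, sd_act a x = y.
Proof.
exists (mk (heis_mul y (- x)) 0).
by rewrite sd_actE phi0 -heis_mulA heis_mulN heis_mul_0.
Qed.

Lemma sd_effective a : sd_act a = id -> a = 1%g.
Proof.
have [p [s ->]] := mkP a => H.
have p0 : p = 0.
  by have := congr1 (fun f => f 0) H; rewrite sd_actE (lin0 (phi_linear s)) heis_mul_0.
apply: semidirect_eq => //=; apply/funext => x.
by have := congr1 (fun f => f x) H; rewrite sd_actE p0 heis_mul0 phi0.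
Qed.

Variable t : V -> V.
Hypothesis t_linear : linear t.
Hypothesis phi_diff : forall x s, is_diff s (phi ^~ x) (fun v => v *: phi s (t x)).

Notation c0 := (sd_chart 0).

Lemma chart_one : cmap c0 (mk 0 0) = psi (0, 0).
Proof. by rewrite /= local_angle_mk// subrr normr0. Qed.

Lemma is_diff_heis_mul2 (U : normedModType R) (a da a' da' : U -> V) x :
  is_diff x a da -> is_diff x a' da' ->
  is_diff x (fun y => heis_mul (a y) (a' y)) (fun v => da v + da' v +
     (2^-1 *: heis_bracket (a x) (da' v) + 2^-1 *: heis_bracket (da v) (a' x))).
Proof.
move=> H H'; pose beta (u w : V) : V := 2^-1 *: heis_bracket u w.
have bl w : linear (beta ^~ w).
  by move=> c u u'; rewrite /beta heis_bracket_linearl scalerDr !scalerA mulrC.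
have br w : linear (beta w).
  by move=> c u u'; rewrite /beta heis_bracket_linearr scalerDr !scalerA mulrC.
exact: (is_diffD (is_diffD H H') (is_diff_bilin Vf Vf bl br H H')).
Qed.

Let is_diff_rot x : is_diff (psi (0, 0)) (fun y => phi (psi' y).2 x)
  (fun v => (psi' v).2 *: t x).
Proof.
have H : is_diff ((psi' (psi (0, 0))).2) (phi ^~ x) (fun v => v *: t x).
  by rewrite psiK; apply: (is_diff_eq (phi_diff x 0)); apply/funext => v; rewrite phi0.
exact: (is_diff_comp_linear psi'2_linear psi'2_c H).
Qed.

Let is_diff_pt : is_diff (psi (0, 0)) (fun y => (psi' y).1) (fun v => (psi' v).1).
Proof. exact: (is_diff_linear _ psi'1_linear psi'1_c). Qed.

(** Conjugating the element of point [v] and angle [tau] keeps the angle and gives the point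
    [p * phi s v * (- phi tau p)]. The last factor accounts for the term in [t p]. *)
Lemma Ad_mk p s X : Ad (G := sd_lie) c0 (mk p s) X =
  psi (phi s (psi' X).1 + heis_bracket p (phi s (psi' X).1)
       - (psi' X).2 *: translate p (t p), (psi' X).2).
Proof.
rewrite /Ad oneE chart_one.
pose L y := translate p (phi s (psi' y).1).
have Ll : linear L.
  by move=> k u v; rewrite /L psi'1_linear phi_linear translate_linear.
have Lc := fin_dim_linear_continuous (fin_dim_rV R d) Ll.
have dA : is_diff (psi (0, 0)) (fun y => L y + p) L.
  exact: (is_diff_comp_affine (f := id) (df := id) Ll Lc (is_diff_id _)).
have dB := is_diffN (is_diff_rot p).
have dS := is_diff_linear (psi (0, 0)) psi'2_linear psi'2_c.
have dF := is_diff_linear_comp psi_linear psi_c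
  (is_diff_pair (is_diff_heis_mul2 dA dB) dS).
(* The chart returns the angle of [q] itself only while that angle is smaller than [r]. *)
have near_F : \forall q \near psi (0, 0),
    psi (heis_mul (L q + p) (- phi (psi' q).2 p), (psi' q).2) =
    cmap c0 (mk p s * cinv c0 q * (mk p s)^-1)%g.
  have q0 : `|(psi' (psi (0, 0))).2| < r by rewrite psiK normr0.
  apply: (near_norm_lt psi'2_c q0) => q qr.
  have E1 : s + (psi' q).2 - s = (psi' q).2 by rewrite addrAC subrr add0r.
  have E2 : phi (s + (psi' q).2) (- phi (- s) p) = - phi (psi' q).2 p.
    by rewrite (linN (phi_linear _)) -phiD E1.
  rewrite [cinv c0 q]/= invE !mulE E1 E2 /= local_angle_mk ?subr0//.
  by rewrite (heis_mulE p).
have L0 : L (psi (0, 0)) = 0 by rewrite /L psiK /= (lin0 (phi_linear s)) translate_at0.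
rewrite (diff_valE (near_eq_is_diff near_F dF)); congr psi.
rewrite !fctE psiK phi0 L0 add0r /L; congr pair.
rewrite (linN (heis_bracket_linearr p)) (linZ (heis_bracket_linearr p)).
have E e : heis_bracket (translate p e) (- p) = heis_bracket p e.
  by rewrite heis_bracket_translatel (linN (heis_bracket_linearr e)) -heis_bracketC.
rewrite E.
rewrite /translate.
move: (phi s (psi' X).1) (heis_bracket p (phi s (psi' X).1)) => e h.
move: (t p) (heis_bracket p (t p)) (psi' X).2 => a c k.
(* One half of the bracket comes from translating by [p], the other from multiplying by the inverse;
   together they give the full bracket. *)
have hE : h = 2^-1 *: h + 2^-1 *: h.
  by rewrite -scalerDl -[LHS]scale1r; congr (_ *: _); field.
rewrite {3}hE scalerDr opprD scalerN !scalerA [k * _]mulrC -!addrA; congr (_ + _).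
by congr (_ + _); rewrite addrA [RHS]addrC.
Qed.

(** The Lie algebra is the Heisenberg algebra extended by a line acting through [t]. The angle
    component is zero because conjugation preserves angles. *)
Lemma sd_bracket X Y : lie_bracket (G := sd_lie) c0 X Y =
  psi ((psi' X).2 *: t (psi' Y).1 + heis_bracket (psi' X).1 (psi' Y).1
       - (psi' Y).2 *: t (psi' X).1, 0).
Proof.
rewrite /lie_bracket oneE chart_one.
set y := (psi' Y).1; set k := (psi' Y).2.
pose F q := psi (phi (psi' q).2 y + heis_bracket (psi' q).1 (phi (psi' q).2 y)
  - k *: (t (psi' q).1 + 2^-1 *: heis_bracket (psi' q).1 (t (psi' q).1)), k).
have -> : (fun p => Ad (G := sd_lie) c0 (cinv c0 p) Y) = F.
  by apply/funext => q; rewrite Ad_mk.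
have bl w : linear (fun u : V => heis_bracket u w) by exact: heis_bracket_linearl.
have br w : linear (heis_bracket w : V -> V) by exact: heis_bracket_linearr.
have tc := fin_dim_linear_continuous Vf t_linear.
have sl k' : linear (fun u : V => k' *: u) by move=> c u u'; rewrite scalerDr !scalerA mulrC.
have sc k' := fin_dim_linear_continuous Vf (sl k').
have dR := is_diff_rot y.
have dB := is_diff_bilin Vf Vf bl br is_diff_pt dR.
have dt := is_diff_linear_comp t_linear tc is_diff_pt.
have dC := is_diff_linear_comp (sl 2^-1) (@sc 2^-1) (is_diff_bilin Vf Vf bl br is_diff_pt dt).
have dD := is_diff_linear_comp (sl k) (@sc k) (is_diffD dt dC).
have dF : is_diff (psi (0, 0)) F _ := is_diff_linear_comp psi_linear psi_c
  (is_diff_pair (is_diffD (is_diffD dR dB) (is_diffN dD)) (is_diff_cst k (psi (0, 0)))).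
rewrite (diff_valE dF); congr psi; rewrite !fctE psiK phi0 /=.
rewrite (lin0 (bl _)) (lin0 t_linear) (lin0 (br _)) (lin0 (bl _)) !add0r scaler0 addr0.
by [].
Qed.

Lemma sd_orbit X : 'd (fun p => sd_act (cinv c0 p) 0) (cmap c0 1%g) X = (psi' X).1.
Proof.
rewrite (_ : (fun p => _) = fun p => (psi' p).1); last first.
  by apply/funext => p; rewrite sd_actE (lin0 (phi_linear _)) heis_mul_0.
exact: (diff_valE (is_diff_linear _ psi'1_linear psi'1_c)).
Qed.

Lemma sd_isotropy a : sd_act a 0 = 0 <-> exists s, a = mk 0 s.
Proof.
have [p [s ->]] := mkP a; rewrite sd_actE (lin0 (phi_linear s)) heis_mul_0.
split=> [->|[s' /(congr1 pt)]//]; by exists s.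
Qed.

(** A curve in the isotropy group has constant point 0, so its velocity is vertical; conversely the
    curves [mk 0 (s * k)] realise every vertical vector. *)
Lemma sd_isotropy_algebra X :
  subgroup_lie_algebra (G := sd_lie) c0 [set a | sd_act a 0 = 0] X <->
  exists k : R, X = k *: psi (0, 1).
Proof.
split=> [[gam [_ gamK gamX]]|[k ->]].
  have X1 : (psi' X).1 = 0.
    have := is_diff_is_derive (1 : R) (is_diff_linear_comp psi'1_linear psi'1_c
      (is_derive_is_diff gamX)).
    rewrite scale1r (_ : (fun s => _) = cst 0); last first.
      by apply/funext => s; have /sd_isotropy[s' ->] := gamK s; rewrite /= psiK.
    by move=> [_ <-]; exact: derive_cst.
  exists (psi' X).2; rewrite -(linZ psi_linear) -[LHS]psi'K; congr psi.
  by rewrite [LHS]surjective_pairing X1; congr pair; rewrite /= ?scaler0// [RHS]mulr1.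
have kl : linear (fun s : R => s * k) by move=> a u v; rewrite mulrDl -mulrA.
have kc := fin_dim_linear_continuous (fin_dim_R R) kl.
exists (fun s => mk 0 (s * k)); split.
- split=> [s s'|c [s0 _ <-]].
    by rewrite mulE (lin0 (phi_linear _)) heis_mul_0 mulrDl.
  have z_smooth : smooth (fun _ : R => 0 : V) by exact: smooth_cst.
  have oT : open (setT : set R) by exact: openT.
  apply: (eq_smooth_on (smooth_on_chart s0 oT z_smooth (smooth_linear kl kc))) => //.
  by apply/seteqP; split=> s //= -[].
- by move=> s; apply/sd_isotropy; exists (s * k).
- have H : is_derive (0 : R) (1 : R) (fun s : R => psi (0, s * k)) (k *: psi (0, 1)).
    have l : linear (fun s : R => psi (0, s * k)).
      move=> a u v; rewrite -psi_linear; congr psi; congr pair; rewrite /= ?scaler0 ?addr0//.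
      exact: kl.
    have := is_diff_is_derive (1 : R) (is_diff_linear 0 l (fin_dim_linear_continuous (fin_dim_R R) l)).
    rewrite -(linZ psi_linear); congr is_derive; congr psi; congr pair => /=; rewrite ?scaler0//.
    by rewrite mul1r [RHS]mulr1.
  apply: near_eq_is_derive H.
  apply: (near_norm_lt (F := fun s : R => s * k) (e := r)) => //; first by rewrite mul0r normr0.
  by move=> s sr /=; rewrite local_angle_mk ?subr0.
Qed.

(** * The naturally reductive complement *)

Section NaturallyReductive.
Variables (g : V -> V -> V -> R) (z : V) (om : V -> V -> R).
Notation b := (g 0).
Hypothesis act_isometry : forall a, Defs.isometry g (sd_act a).
Hypotheses (b_form : bilinear_form b) (bzz_neq0 : b z z != 0).
Hypotheses (b_sym : forall u w, b u w = b w u) (om_anti : forall u w, om w u = - om u w).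
Hypothesis t_skew : forall u w, b (t u) w = - b u (t w).
Hypothesis t_om : forall u w, b (t u) w = b z z * om u w.
Hypothesis bracket_om : forall u w, heis_bracket u w = om u w *: z.
Hypothesis b_phi : forall s u, b z (phi s u) = b z u.

Let mu (u : V) : R := b z u / b z z.

Let mu_linear a u w : mu (a *: u + w) = a * mu u + mu w.
Proof. by rewrite /mu (b_form a u w z).2 mulrDl mulrA. Qed.

Let graph (u : V) := psi (u, mu u).

Let graph_linear : linear graph.
Proof.
by move=> a u w; rewrite /graph -psi_linear; congr psi; congr pair; exact: mu_linear.
Qed.

Let Graph : {linear V -> 'rV[R]_d} := HB.pack graph
  (GRing.isLinear.Build _ _ _ _ graph graph_linear).

(* The complement of the isotropy algebra is the graph of [mu]; any other
   multiple of [mu] would violate the naturally reductive identity. *)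
Let m : {vspace 'rV[R]_d} := limg (linfun Graph).
Let k : {vspace 'rV[R]_d} := <[psi (0, 1)%R]>%VS.

Let mP X : X \in m <-> exists u, X = graph u.
Proof.
split=> [/memv_imgP[u _ ->]|[u ->]]; first by exists u; rewrite lfunE.
by apply/memv_imgP; exists u; rewrite ?memvf// lfunE.
Qed.

Let psiE X : X = psi ((psi' X).1, (psi' X).2).
Proof. by rewrite -surjective_pairing psi'K. Qed.

Let psi0E s : psi (0, s) = s *: psi (0, 1).
Proof.
by rewrite -(linZ psi_linear); congr psi; congr pair; rewrite /= ?scaler0// [RHS]mulr1.
Qed.

Let mk0 : (m :&: k = 0)%VS.
Proof.
apply/eqP; rewrite -subv0; apply/subvP => X; rewrite memv_cap memv0 => /andP[].
move=> /mP[u ->] /vlineP[s /(congr1 psi')]; rewrite -psi0E !psiK => -[u0 _].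
by rewrite /graph u0; apply/eqP; exact: (lin0 graph_linear).
Qed.

Let split_mk X : X = graph (psi' X).1 + psi (0, (psi' X).2 - mu (psi' X).1).
Proof.
rewrite /graph -(linD psi_linear) [LHS]psiE; congr psi; congr pair => /=.
  by rewrite addr0.
by rewrite addrC subrK.
Qed.

Let mkT : (m + k = fullv)%VS.
Proof.
apply/eqP; rewrite eqEsubv subvf; apply/subvP => X _; rewrite (split_mk X).
apply: memv_add; first by apply/mP; exists (psi' X).1.
by rewrite psi0E; apply/vlineP; exists ((psi' X).2 - mu (psi' X).1).
Qed.

Let projE X : daddv_pi m k X = graph (psi' X).1.
Proof.
have kd u : u \in k -> daddv_pi m k u = 0.
  (* The two projections add up to the identity and the one onto [k] fixes [u], so the one onto [m]
     kills it. *)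
  move=> uk; have := daddv_pi_add mk0 (_ : u \in (m + k)%VS).
  rewrite mkT memvf => /(_ isT).
  rewrite [X in _ + X](daddv_pi_id _ uk); last by rewrite capvC mk0.
  by move/(canRL (addrK _)); rewrite subrr.
rewrite {1}(split_mk X) linearD /= [X in X + _](daddv_pi_id mk0); last by apply/mP; exists (psi' X).1.
by rewrite kd ?addr0// psi0E; apply/vlineP; exists ((psi' X).2 - mu (psi' X).1).
Qed.

Lemma sd_naturally_reductive : naturally_reductive g.
Proof.
exists sd_lie, (@sd_act), 0, c0, k, m; split.
- split; first by exists 0.
  by exists 0; rewrite subr0 normr0.
- exact: sd_smooth_action.
- by split=> // a; exact: sd_effective.
- exact: sd_transitive.
- split=> [X||a X aK Xm|X Y W].
  + by rewrite sd_isotropy_algebra; split=> [/vlineP//|[c ->]]; apply/vlineP; exists c.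
  + by split; [exact: mk0|exact: mkT].
  (* An isotropy element [mk 0 s] sends [graph u] to [graph (phi s u)], because [phi s] preserves
     the scalar product with [z] and hence [mu]. *)
  + have [s ->] := (sd_isotropy a).1 aK; move/mP : Xm => [u ->].
    rewrite Ad_mk psiK /=; apply/mP; exists (phi s u); congr psi.
    have t0 : t 0 = 0 by exact: (lin0 t_linear).
    by rewrite heis_bracket0l addr0 t0 translate_at0 scaler0 subr0 /mu b_phi.
  + move=> /mP[x ->] /mP[y ->] /mP[w ->].
    (* The point component of the bracket of two graph vectors. Projecting along [k] does not change
       it, and the orbit map retains nothing else. *)
    pose br u v := mu u *: t v + heis_bracket u v - mu v *: t u.
    have brE u v : (psi' (daddv_pi m k (lie_bracket (G := sd_lie) c0 (graph u) (graph v)))).1 = br u v.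
      by rewrite projE psiK sd_bracket !psiK.
    transitivity (b (br x y) w + b y (br x w)).
      by congr (b _ _ + b _ _); rewrite sd_orbit ?brE// psiK.
    have muE u : b z u = b z z * mu u by rewrite /mu mulrC divfK.
    have zt u v : b u (t v) = - (b z z * om u v) by rewrite -t_om t_skew opprK.
    have -> : b (br x y) w = mu x * (b z z * om y w) + om x y * (b z z * mu w)
        - mu y * (b z z * om x w).
      by rewrite /br bracket_om (formDl b_form) (formDl b_form) (formNl b_form)
        !(formZl b_form) !t_om (muE w).
    have -> : b y (br x w) = mu x * - (b z z * om y w) + om x w * (b z z * mu y)
        - mu w * - (b z z * om y x).
      by rewrite /br bracket_om (formDr b_form) (formDr b_form) (formNr b_form)
        !(formZr b_form) !zt (b_sym y z) (muE y).
    rewrite (om_anti x y).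
    (* The terms in [mu x] cancel by skewness of [t]; each bracket term cancels against a slope term
       of the other summand. *)
    have alg (p q s e p' q' s' : R) : p * (e * p') + q' * (e * q) - s * (e * s') +
      (p * - (e * p') + s' * (e * s) - q * - (e * - q')) = 0 by ring.
    exact: alg.
Qed.

End NaturallyReductive.
End Charts.
End SemidirectProduct.

(** * Naturally reductive metrics *)

Lemma linear_coordinates (K : fieldType) (W : vectType K) :
  exists d (psi : W -> 'rV[K]_d) (psi' : 'rV[K]_d -> W),
    [/\ linear psi, linear psi', cancel psi psi' & cancel psi' psi].
Proof.
pose X := vbasis (fullv : {vspace W}).
have Xfree : free X by apply: basis_free; exact: vbasisP.
exists (\dim (fullv : {vspace W})), (fun w => \row_i coord X i w),
  (fun x : 'rV[K]_(\dim (fullv : {vspace W})) => \sum_i x 0 i *: X`_i); split=> [a u w|a u w|w|x].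
- by apply/rowP => i; rewrite !mxE linearP.
- rewrite scaler_sumr -big_split; apply: eq_bigr => i _.
  by rewrite !mxE scalerDl scalerA.
- under eq_bigr => i _ do rewrite mxE.
  by rewrite [RHS](coord_vbasis (memvf w)).
- by apply/rowP => i; rewrite mxE coord_sum_free.
Qed.

(** A curve with nonzero velocity does not return to its starting point at once, since its
    difference quotients stay away from zero. *)
Lemma is_diff_nonzero_small (R : realType) (W : normedModType R) (f : R -> W) (c : W) :
  is_diff (0 : R) f (fun v => v *: c) -> c != 0 ->
  exists2 r, 0 < r & forall s, `|s| < r + r -> f s = f 0 -> s = 0.
Proof.
move=> fd c0.
have := is_diff_is_derive (1 : R) fd; rewrite scale1r => -[df dfE].
have H : h^-1 *: (f (h *: 1 + 0) - f 0) @[h --> 0^'] --> c by rewrite -dfE; exact: df.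
have : \forall h \near (0 : R)^', h^-1 *: (f (h *: 1 + 0) - f 0) != 0.
  exact: (cvgr_neq0 _ H c0).
rewrite near_withinE => /nbhs_normP[e /= e0 eP].
(* Halved because angles in one chart of radius [r] may be almost [r + r] apart. *)
exists (e / 2); first by rewrite divr_gt0.
move=> s; rewrite -splitr => se fs; apply/eqP/negPn/negP => s0.
have := eP s; rewrite /= sub0r normrN => /(_ se s0).
by rewrite addr0 [s *: 1]mulr1 fs subrr scaler0 eqxx.
Qed.

Section NaturallyReductive.
Context (R : realType) (n : nat).
Notation V := (heis R n).
Variable g : V -> V -> V -> R.
Hypothesis n_gt0 : (0 < n)%N.
Hypothesis g_metric : pseudo_riemannian_metric g.
Hypothesis g_left : left_invariant g.
Hypothesis center_nondegenerate : forall c : V, heis_center c ->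
  (forall c' : V, heis_center c' -> g 0 c c' = 0) -> c = 0.

Lemma heis_naturally_reductive : naturally_reductive g.
Proof.
pose z : V := (0, 0, 1).
have zP : @heis_center R n = [set a *: z | a in setT].
  apply/seteqP; split=> [c /heis_centerE[a ->]|c [a _ <-]]; first by exists a.
  by apply/heis_centerE; exists a.
have Vf := @heis_fin_dim R n.
have bb := metric_form g_metric 0.
have bS := metric_sym g_metric 0.
have bN := @metric_nondegenerate _ _ _ g_metric 0.
have bzz := bzz_neq0 g_metric center_nondegenerate zP.
have oA := @om_anti R n z.
have oK := om_kernel zP.
have ob := @om_form R n z.
have brE := bracketE zP.
have [t tP] := exists_t z g_metric.
have tO := t_om g_metric zP tP.
have tS := skew_t bS oA tO.
have t_perp := perp_t bS oA oK tO.
have t_lin : linear t.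
  move=> a u w; apply: (form_inj bb bN) => y.
  by rewrite (bb a _ _ y).1 !tO (ob a u w y).1; ring.
have tz : t z = 0 by apply: bN => w; rewrite tO (om_z oA oK w).1 mulr0.
have D_skew u w : g 0 (t u) w + g 0 u (t w) = 0 by rewrite tS addNr.
have D_om u w : om z (t u) w + om z u (t w) = 0.
  by rewrite (om_t bS oA bzz tO) (oA (t w) u) subrr.
have [phi phiP] := flow_exists Vf t_lin.
have phi0 := flow0 Vf phiP.
have phiD := flowD Vf t_lin phiP.
have phi_lin := flow_linear Vf t_lin phiP.
have phi_sm := smooth_flow_curve Vf t_lin phiP.
have phi_z := flow_center t_lin phiP tz.
have phi_br := flow_bracket zP t_lin phiP tz D_om.
have phi_form := flow_form g_metric t_lin phiP D_skew.
have phi_iso := flow_isometry g_metric g_left zP t_lin phiP tz D_skew D_om.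
(* For positive [n] the bracket is not zero, hence neither is [t]. A vector not killed by [t] has a
   flow curve of nonzero velocity, which supplies the chart radius. *)
have [u0 u0P] : exists u, t u != 0.
  apply: contrapT => H.
  have t0 u : t u = 0 by apply/eqP/negPn/negP => tu; apply: H; exists u.
  have om0 u w : om z u w = 0.
    by apply: (mulfI bzz); rewrite -tO t0 (form0l bb) mulr0.
  pose i0 := Ordinal n_gt0.
  have := om0 (delta_mx 0 i0, 0, 0) (0, delta_mx 0 i0, 0).
  rewrite /om /heis_bracket /= divr1 mul0mx trmx_delta mul_delta_mx !mxE !eqxx.
  by rewrite subr0 => /eqP; rewrite oner_eq0.
have u0P' : phi 0 (t u0) != 0 by rewrite phi0.
have [r r0 small] := is_diff_nonzero_small (is_diff_flow Vf t_lin phiP u0 0) u0P'.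
have phi_small s : `|s| < r + r -> (forall x, phi s x = x) -> s = 0.
  by move=> sr H; apply: small => //; rewrite H phi0.
have [d [psi [psi' [psi_l psi'_l psiK psi'K]]]] := linear_coordinates (V * R)%type.
apply: (sd_naturally_reductive (psi := psi) (psi' := psi') (phi_smooth := phi_sm)
  (phi0 := phi0) (phiD := phiD) (phi_linear := phi_lin) (phi_bracket := phi_br)
  (r_gt0 := r0) (phi_small := phi_small) (psi_linear := psi_l) (psi'_linear := psi'_l)
  (psiK := psiK) (psi'K := psi'K) t_lin (is_diff_flow Vf t_lin phiP)
  _ bb bzz bS oA tS tO brE) => [a|s u].
  have [p [s ->]] := mkP a.
  apply: (heis_mul_linear_isometry p g_left (phi_lin s) (phi_lin (- s))) => //.
    exact: (flowK t_lin phiP).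
  by move=> x; rewrite -{1}[s]opprK (flowK t_lin phiP).
(* The flow is isometric and fixes [z], so it preserves the scalar product with [z]. *)
by rewrite -[z in LHS](phi_z s) phi_form.
Qed.

End NaturallyReductive.

Theorem proposition4p3 (R : realType) (n : nat)
    (g : heis R n -> heis R n -> heis R n -> R)
    (n_gt0 : (0 < n)%N)
    (g_metric : pseudo_riemannian_metric g)
    (g_left : left_invariant g)
    (center_nondegenerate : forall c : heis R n, heis_center c ->
       (forall c' : heis R n, heis_center c' -> g 0 c c' = 0) -> c = 0) :
  naturally_reductive g /\
  forall (z : heis R n) (v : {vspace heis R n}),
    @heis_center R n = [set a *: z | a in setT] ->
    (forall u : heis R n, u \in v <-> g 0 z u = 0) ->
    let B := fun u w : subvs_of v => g 0 (vsval u) (vsval w) in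
    let is_t := fun t : 'End(subvs_of v) => forall u w : subvs_of v,
      B (t u) w = g 0 z (heis_bracket (vsval u) (vsval w)) in
    (exists! t : 'End(subvs_of v), is_t t) /\
    forall t : 'End(subvs_of v), is_t t ->
      skew_adjoint B t /\
      isotropy_lie_algebra g 0 =
        [set A : {linear heis R n -> heis R n} |
          exists2 C : 'End(subvs_of v), centralizer (skew_adjoint B) t C &
            A z = 0 /\ forall u : subvs_of v, A (vsval u) = vsval (C u)].
Proof.
split; first exact: heis_naturally_reductive.
move=> z v zP vP; have [t tP] := exists_t z g_metric.
exact: (isotropy_subspace g_metric g_left center_nondegenerate zP tP vP).
Qed.
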